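(* Let $K$ be a field of characteristic $c\ge 0$ and $n\ge 1$. Let $H \in K(x)^n$ be such that $\operatorname{trdeg}_K K(tH) \le 2$, and let $\tilde H$ be the primitive part of $H$ (with $\tilde H:=0$ if $H=0$). Then the following statements are equivalent: (1) $\mathcal{J} H \cdot H = (\operatorname{tr} \mathcal{J} H) \cdot H$; (2) $\mathcal{J} \tilde{H} \cdot \tilde{H}(y) = (\operatorname{tr} \mathcal{J} \tilde{H}) \cdot \tilde{H}(y) = 0$; (3) there exist $h \in K[y_1,y_2]^n$ which is homogeneous or zero, such that $\deg h > 0$ implies $c \nmid \deg h$, and $p,q \in K[x]$ with $\gcd\{p,q\} = 1$, such that $H = g \cdot h(p,q)$ for some $g \in K(x)$, and $\mathcal{J} (h(p,q)) \cdot h(p,q) = 0$; (4) there exist $f \in K[y_1]^n$ and $p,q \in K[x]$ such that $H = g \cdot f(p/q)$ for some $g \in K(x)$ and $\mathcal{J} p \cdot f = \mathcal{J} q \cdot f = 0$; (5) there exist $f=(f_1,\dots,f_n)$ and $p,q$ as in (4) such that in addition $\gcd\{f_1,f_2,\ldots,f_n\} = 1$ and $\gcd\{p,q\} = 1$. Furthermore, if any of (1), (2), (3), (4) and (5) is satisfied, then $H$ is a $K[x]$-linear combination of $n - \operatorname{rk} \mathcal{J} \tilde{H}$ vectors over $K$ (i.e. vectors in $K^n$).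
   Context: $x=(x_1,\dots,x_n)$ and $y=(y_1,\dots,y_n)$ are $n$-tuples of variables ($y_1,y_2$ denote variables independent of $x$), $t$ is a further indeterminate; $K(x)$ is the fraction field of $K[x]$. $tH=(tH_1,\dots,tH_n)$ and $K(tH)=K(tH_1,\dots,tH_n)$. $\mathcal{J}F$ is the Jacobian matrix $(\partial F_i/\partial x_j)_{i,j}$ with respect to $x$ of a tuple $F$ of rational functions; tuples multiplied by matrices are regarded as column vectors, and for a single $p\in K[x]$, $\mathcal{J}p$ is the row vector $(\partial p/\partial x_1,\dots,\partial p/\partial x_n)$. $\operatorname{tr}$ is the trace, $\operatorname{rk}$ the rank over $K(x)$. $\tilde H(y)$ is obtained from $\tilde H$ by substituting $x_i\mapsto y_i$; in (4), $\mathcal{J}p\cdot f$ and $\mathcal{J}q\cdot f$ are elements of $K[x][y_1]$, where $f=f(y_1)$ and $x$, $y_1$ are independent variables. Quotients such as $p/q$ presuppose nonzero denominators. A tuple $F\in K[x]^n$ is primitive if $F\ne0$ and every common divisor of its components is a unit. For $H\in K(x)^n$ nonzero, the primitive part $\tilde H$ of $H$ is the primitive tuple in $K[x]^n$ that is a $K(x)$-multiple of $H$; it is unique up to multiplication by an element of $K\setminus\{0\}$. A nonzero tuple $h$ is homogeneous if all its nonzero components are homogeneous of the same degree $\deg h$.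
   Formalization: The final claim is false for non-polynomial H (n=1, H=1/x_1): it is proved that H is a K(x)-linear combination of n − rk J H̃ vectors over K, with coefficients in K[x] whenever H is in K[x]^n. *)

(* Defs.v *)
From mathcomp Require Import all_boot all_algebra ring.
From mathcomp Require Import mpoly.

Set Implicit Arguments.
Unset Strict Implicit.
Unset Printing Implicit Defensive.

Import GRing.Theory.

Local Open Scope ring_scope.

Definition has_char (K : fieldType) (c : nat) : Prop :=
  forall m : nat, (m%:R == 0 :> K) = (c %| m)%N.

(* The gcd of s is 1. Since every element divides 0, this fails when all the  *)
(* entries of s are 0.                                                        *)
Definition gcd_one (R : idomainType) (s : seq R) : Prop :=
  forall d : R, (forall a, a \in s -> exists b, a = b * d) ->
    d \is a GRing.unit.

Definition gcd_one_cv (R : idomainType) (n : nat) (F : 'cV[R]_n) : Prop :=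
  gcd_one [seq F i 0 | i <- enum 'I_n].

(* Transcendence degree of a subset E of an extension iota : K -> L, as the   *)
(* supremum of the sizes of algebraically independent families in E.          *)
Section TranscendenceDegree.
Variables (K L : fieldType) (iota : {rmorphism K -> L}).

Definition alg_indep (k : nat) (z : 'I_k -> L) : Prop :=
  forall P : {mpoly K[k]}, mmap iota z P = 0 -> P = 0.

Definition adjoin (n : nat) (z : 'I_n -> L) (w : L) : Prop :=
  exists P Q : {mpoly K[n]},
    mmap iota z Q != 0 /\ w = mmap iota z P / mmap iota z Q.

Definition trdeg_le (E : L -> Prop) (d : nat) : Prop :=
  forall (k : nat) (z : 'I_k -> L),
    (forall i, E (z i)) -> alg_indep z -> (k <= d)%N.

End TranscendenceDegree.

Section RationalFunctions.
Variables (K : fieldType) (n : nat).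

Definition ratfun : fieldType := {fraction {mpoly K[n]}}.

Definition pfrac : {rmorphism {mpoly K[n]} -> ratfun} :=
  @FracField.tofrac {mpoly K[n]}.

Definition cfrac : {rmorphism K -> ratfun} := pfrac \o @mpolyC n K.

Definition is_polynomial (r : ratfun) : Prop := exists p, r = pfrac p.

(* Quotient rule on a representative; see fderivE for independence of the     *)
(* representative.                                                            *)
Definition fderiv (j : 'I_n) (r : ratfun) : ratfun :=
  let a := \n_(repr r) in let b := \d_(repr r) in
  pfrac (a^`M(j) * b - a * b^`M(j)) / pfrac (b ^+ 2).

Definition jacobian_frac (F : 'cV[ratfun]_n) : 'M[ratfun]_n :=
  \matrix_(i, j) fderiv j (F i 0).

Definition jacobian (F : 'cV[{mpoly K[n]}]_n) : 'M[{mpoly K[n]}]_n :=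
  \matrix_(i, j) (F i 0)^`M(j).

Definition gradient (p : {mpoly K[n]}) : 'rV[{mpoly K[n]}]_n :=
  \row_j p^`M(j).

Definition primitive (F : 'cV[{mpoly K[n]}]_n) : Prop :=
  F != 0 /\ gcd_one_cv F.

(* A relation, since the primitive part is only unique up to K \ {0}.         *)
Definition primitive_part (H : 'cV[ratfun]_n) (Ht : 'cV[{mpoly K[n]}]_n) :
    Prop :=
  if H == 0 then Ht = 0
  else primitive Ht /\ exists g : ratfun, map_mx pfrac Ht = g *: H.

(* K[x, y] is represented as K[x][y]: pconst_y views an element of K[x] as    *)
(* constant in y, and subst_y replaces each x_i by y_i.                       *)
Definition pconst_y (p : {mpoly K[n]}) : {mpoly {mpoly K[n]}[n]} := p%:MP.

Definition subst_y (p : {mpoly K[n]}) : {mpoly {mpoly K[n]}[n]} :=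
  map_mpoly (@mpolyC n K) p.

(* K(x)(t), with t = 'X.                                                      *)
Definition ratfun_t : fieldType := {fraction {poly ratfun}}.

Definition tfrac : {rmorphism {poly ratfun} -> ratfun_t} :=
  @FracField.tofrac {poly ratfun}.

Definition cfrac_t : {rmorphism K -> ratfun_t} := tfrac \o polyC \o cfrac.

Definition t_scale (H : 'cV[ratfun]_n) (i : 'I_n) : ratfun_t :=
  tfrac ('X * (H i 0)%:P).

Definition homog_tuple (m : nat) (h : 'cV[{mpoly K[m]}]_n) (d : nat) : Prop :=
  h != 0 /\ forall i, h i 0 \is d.-homog.

Definition subst2 (h : 'cV[{mpoly K[2]}]_n) (p q : {mpoly K[n]}) :
    'cV[{mpoly K[n]}]_n :=
  \col_i (h i 0 \mPo [tuple p; q]).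

Definition eval_frac (f : 'cV[{poly K}]_n) (r : ratfun) : 'cV[ratfun]_n :=
  \col_i (map_poly cfrac (f i 0)).[r].

(* The element (J p) . f of K[x][y_1], as a 1 x 1 matrix.                     *)
Definition gradient_dot (p : {mpoly K[n]}) (f : 'cV[{poly K}]_n) :
    'M[{poly {mpoly K[n]}}]_1 :=
  map_mx polyC (gradient p) *m map_mx (map_poly (@mpolyC n K)) f.

Lemma fderivE (j : 'I_n) (a b : {mpoly K[n]}) : b != 0 ->
  fderiv j (pfrac a / pfrac b) =
    pfrac (a^`M(j) * b - a * b^`M(j)) / pfrac (b ^+ 2).
Proof.
move=> b0; set r := pfrac a / pfrac b; rewrite /fderiv.
set u := \n_(repr r); set v := \d_(repr r).
have v0 : v != 0 by exact: denom_ratioP.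
have inj0 (p : {mpoly K[n]}) : p != 0 -> pfrac p != 0.
  by rewrite /pfrac /= tofrac_eq0.
have rE : r = pfrac u / pfrac v.
  apply: (canRL (mulfK (inj0 _ v0))).
  rewrite -[LHS]/(FracField.mul r (FracField.tofrac v)).
  rewrite -[RHS]/(FracField.tofrac u) -[r]reprK !piE.
  apply/eqmodP; rewrite /= FracField.equivfE /FracField.mulf.
  rewrite !numden_Ratio ?mulr1 ?oner_eq0 ?mulf_neq0 ?oner_neq0 //.
  by rewrite -/u -/v mulrC.
have uvE : u * b = a * v.
  have /eqP : pfrac u / pfrac v = pfrac a / pfrac b by rewrite -rE.
  rewrite eqr_div ?inj0 // -!rmorphM => /eqP.
  by rewrite /pfrac /= => /eqP; rewrite tofrac_eq => /eqP.
have dE : u^`M(j) * b + u * b^`M(j) = a^`M(j) * v + a * v^`M(j).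
  by rewrite -!mderivM uvE.
apply/eqP; rewrite eqr_div ?inj0 ?expf_neq0 // -!rmorphM; apply/eqP.
congr (pfrac _); apply/eqP; rewrite -subr_eq0; apply/eqP.
transitivity (v * b * (u^`M(j) * b + u * b^`M(j) -
                       (a^`M(j) * v + a * v^`M(j)))
              - (v^`M(j) * b + b^`M(j) * v) * (u * b - a * v)); first by ring.
by rewrite dE uvE !subrr !mulr0 subrr.
Qed.
End RationalFunctions.

(* Main.v *)
From HB Require Import structures.
Require Import Defs.
From mathcomp Require Import all_boot all_algebra ring.
From mathcomp Require Import mpoly.
From mathcomp Require boolp.

(* Lüroth part.  The ratios H_i / H_j generate a subfield L of K(x) every      *)
(* element of which is algebraic over K(v), for a nonconstant v = a/b in L.    *)
(* Let m in L[y] be a prime factor of a(y) - v b(y) with m(x) = 0; then m      *)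
(* divides e(y) - w f(y) for every w = e/f in L.  Let S in K[x][y] be the      *)
(* primitive multiple of m and u = p/q a nonconstant ratio of two of its       *)
(* coefficients.  As u is in L, S divides q(x) p(y) - p(x) q(y), and comparing *)
(* degrees in x shows that the cofactor lies in K[y].  A K(u)-linear           *)
(* disjointness argument then gives L = K(u), whence H = g f(p/q).             *)
(*                                                                            *)
(* Tangency part.  Put r = p/q, with f and (p, q) primitive.  Condition (1)    *)
(* reads (J r . f(r)) f'(r) = (J r . f'(r)) f(r).  If f and f' are independent,*)
(* both scalars vanish.  Now J p . f(y) - y J q . f(y) vanishes at y = r, so   *)
(* that it is a multiple of p - y q of smaller degree in x, hence 0; the same  *)
(* holds for f', and differentiating yields J p . f = J q . f = 0.  If f and   *)
(* f' are dependent, then f' = 0, so f is a polynomial in y^c, and p^c and q^c *)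
(* have zero gradients.                                                        *)

Set Implicit Arguments.
Unset Strict Implicit.
Unset Printing Implicit Defensive.

Import GRing.Theory.

Local Open Scope ring_scope.

(** * Divisibility in GCD domains *)

(** Condition (4) is the centre. By [coef_gdot], J p . f = J q . f = 0 says that p and q have zero
    derivative along each coefficient vector of f, and these vectors lie in K^n. The other
    conditions are compared with this statement about constant directions, called [ratio_form].

    (1) => (4): K(tH) cannot contain three independent elements t H_i0, v, w, so any two elements of
    the field generated by the ratios of the entries of H are dependent over K. By [luroth], H = g
    f(r) ([luroth_tuple]), and [ratio_form_tangent] turns tangency into (4). The engine is
    [root_factor] with [small_multiple_eq0]: a polynomial over K[x] with root p/q is a multiple of q
    y - p, and it is zero if its degree in x is too small.

    (4) => (2): for d large, F = q^d f(p/q) is a K[x]-combination of the coefficient vectors of f,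
    and it has zero derivative along each of them; hence J F . F(y) = 0 and tr J F = 0. Both
    equations survive division by the common factor of F ([jacobian_primitive_part]). (2) => (1):
    put y = x and multiply by a rational function ([tangent_primitive]).

    (4) => (5): common factors cancel ([ratio_form_reduce]). (5) => (3): h is f homogenized in a
    degree d not divisible by c. (3) => (4): h(p, q) is q^d times a tuple in p/q, and invertibility
    of d in K gives back the vanishing derivative of q ([ratio_form_homog]).

    For the last claim, the Jacobian of [Ht] annihilates the coefficient vectors of [Ht], so their
    span has dimension at most n - rk. A projection onto it, defined over K, fixes [Ht] and
    therefore H ([coefficient_projection], [linear_combination]). *)

Definition dvdr (R : idomainType) (d a : R) : Prop := exists b, a = b * d.

(** Only the existence of gcds is asked, not factorization into irreducibles; in this form the
    property passes from [R] to [{poly R}]. *)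
Definition gcd_domain (R : idomainType) : Prop :=
  forall a b : R, exists d,
    [/\ dvdr d a, dvdr d b & forall e, dvdr e a -> dvdr e b -> dvdr e d].

Section Divisibility.
Variable R : idomainType.
Implicit Types (a b c d : R) (s : seq R).

Lemma dvdr_refl a : dvdr a a. Proof. by exists 1; rewrite mul1r. Qed.

Lemma dvdr0 a : dvdr a 0. Proof. by exists 0; rewrite mul0r. Qed.

Lemma dvdr_trans b a c : dvdr a b -> dvdr b c -> dvdr a c.
Proof. by move=> [u ->] [v ->]; exists (v * u); rewrite mulrA. Qed.

Lemma dvdr_mull a b c : dvdr a c -> dvdr a (b * c).
Proof. by move=> [u ->]; exists (b * u); rewrite mulrA. Qed.

Lemma dvdr_mulr a b c : dvdr a b -> dvdr a (b * c).
Proof. by rewrite mulrC; apply: dvdr_mull. Qed.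

Lemma dvdrD a b c : dvdr a b -> dvdr a c -> dvdr a (b + c).
Proof. by move=> [u ->] [v ->]; exists (u + v); rewrite mulrDl. Qed.

Lemma dvdrN a b : dvdr a b -> dvdr a (- b).
Proof. by move=> [u ->]; exists (- u); rewrite mulNr. Qed.

Lemma dvdrB a b c : dvdr a b -> dvdr a c -> dvdr a (b - c).
Proof. by move=> ab ac; apply: dvdrD (dvdrN ac). Qed.

Lemma dvdr_sum (I : Type) (r : seq I) (P : pred I) (F : I -> R) a :
  (forall i, P i -> dvdr a (F i)) -> dvdr a (\sum_(i <- r | P i) F i).
Proof. by move=> aF; elim/big_ind: _ => //; [exact: dvdr0 | exact: dvdrD]. Qed.

Lemma dvd0r a : dvdr 0 a -> a = 0.
Proof. by case=> b ->; rewrite mulr0. Qed.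

Lemma dvdr_mul2r c a b : c != 0 -> dvdr (a * c) (b * c) -> dvdr a b.
Proof.
by move=> c0 [u]; rewrite mulrA => /(mulIf c0) ->; exists u.
Qed.

Lemma dvdr_unit a b : b \is a GRing.unit -> dvdr a b -> a \is a GRing.unit.
Proof. by move=> ub [u bE]; move: ub; rewrite bE unitrM => /andP[]. Qed.

Lemma gcd_oneW s1 s2 : {subset s1 <= s2} -> gcd_one s1 -> gcd_one s2.
Proof. by move=> ss g1 d ds; apply: g1 => a /ss; apply: ds. Qed.

Lemma gcd_one2 a b : gcd_one [:: a; b] <->
  (forall d, dvdr d a -> dvdr d b -> d \is a GRing.unit).
Proof.
split=> ab d; first by move=> da db; apply: ab => x; rewrite !inE => /orP[] /eqP ->.
by move=> h; apply: ab; apply: h; rewrite !inE eqxx ?orbT.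
Qed.

Lemma gcd_one2C a b : gcd_one [:: a; b] -> gcd_one [:: b; a].
Proof. by apply: gcd_oneW => x; rewrite !inE orbC. Qed.

Hypothesis gcdR : gcd_domain R.

Lemma gcd_seq s : exists d, (forall a, a \in s -> dvdr d a) /\
  forall e, (forall a, a \in s -> dvdr e a) -> dvdr e d.
Proof.
elim: s => [|a s [d [ds dP]]]; first by exists 0; split=> // e _; apply: dvdr0.
have [e [ea ed eP]] := gcdR a d; exists e; split.
  move=> b; rewrite inE => /orP[/eqP -> //|/ds].
  exact: dvdr_trans.
move=> f fs; apply: eP; first by apply: fs; rewrite inE eqxx.
by apply: dP => b bs; apply: fs; rewrite inE bs orbT.
Qed.

Lemma gcd_one_factor s : s != [::] ->
  exists d s', s = [seq a * d | a <- s'] /\ gcd_one s'.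
Proof.
move=> s0; have [d [ds dP]] := gcd_seq s.
have [d0|d0] := eqVneq d 0.
  (* All entries vanish, so any cofactors do; ones are coprime because [s] is nonempty. *)
  exists 0, [seq 1 | a <- s]; split.
    rewrite -map_comp -[LHS]map_id; apply/eq_in_map => a /ds.
    by rewrite d0 /= mulr0; exact: dvd0r.
  case: s s0 {ds dP} => // a s _ e /(_ 1); rewrite inE eqxx => /(_ isT).
  by apply: dvdr_unit; rewrite unitr1.
have [s' sE] : exists s', s = [seq a * d | a <- s'].
  elim: s ds {s0 dP} => [|a s IHs] ds; first by exists [::].
  have [|s' ->] := IHs; first by move=> b bs; apply: ds; rewrite inE bs orbT.
  by have [|b ->] := ds a; [rewrite inE eqxx | exists (b :: s')].
exists d, s'; split=> // e es'.
have [u uE] : dvdr (e * d) d.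
  apply: dP => x; rewrite sE => /mapP[b /es' [v bE] ->].
  by exists v; rewrite bE mulrA.
have /(mulIf d0) uE1 : 1 * d = (u * e) * d by rewrite mul1r -mulrA.
by apply: (@dvdr_unit _ 1); [rewrite unitr1 | exists u].
Qed.

Lemma gcd_factor2 a b : exists d a' b',
  [/\ a = a' * d, b = b' * d & gcd_one [:: a'; b']].
Proof.
have [//|d [s' []]] := @gcd_one_factor [:: a; b].
by case: s' => [|a' [|b' [|]]] //= [-> ->] ab; exists d, a', b'.
Qed.

(** A gcd of [a * c] and [b * c] has the form [u * c] with [u] a common divisor of [a] and [b],
    hence a unit. As [a] divides both products, it divides [u * c]. *)
Lemma euclid a b c : gcd_one [:: a; b] -> dvdr a (b * c) -> dvdr a c.
Proof.
move=> /gcd_one2 ab abc; have [->|c0] := eqVneq c 0; first exact: dvdr0.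
have [g [ga gb gP]] := gcdR (a * c) (b * c).
have [u gE] : dvdr c g by apply: gP; apply: dvdr_mull (dvdr_refl c).
rewrite {}gE in ga gb gP.
have uu : u \is a GRing.unit by apply: ab; apply: dvdr_mul2r c0 _.
have [v vE] : dvdr a (u * c) by apply: gP => //; exact: dvdr_mulr (dvdr_refl a).
by exists (u^-1 * v); rewrite -mulrA -vE mulKr.
Qed.

(** Once the gcd of [a] and [c] is removed, what is left of [a] divides every entry of [s] by
    [euclid], so it is a unit. *)
Lemma euclid_seq s a c : gcd_one s -> (forall b, b \in s -> dvdr a (b * c)) ->
  dvdr a c.
Proof.
move=> s1 abc; have [d [a' [c' [aE cE ac]]]] := gcd_factor2 a c.
have [d0|d0] := eqVneq d 0; first by rewrite cE d0 mulr0; apply: dvdr0.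
rewrite aE cE; have ua : a' \is a GRing.unit.
  apply: s1 => b /abc; rewrite aE cE mulrA => /(dvdr_mul2r d0).
  by rewrite mulrC; apply: euclid.
by exists (c' * a'^-1); rewrite mulrA mulrVK.
Qed.

Lemma gcd_oneX a b k : gcd_one [:: a; b] -> gcd_one [:: a; b ^+ k].
Proof.
move=> /gcd_one2 ab; elim: k => [|k /gcd_one2 IHk]; apply/gcd_one2 => d da.
  by rewrite expr0; apply: dvdr_unit; rewrite unitr1.
move=> dbk; apply: IHk => //.
apply: (@euclid d b); last by rewrite -exprS.
by apply/gcd_one2 => e ed; apply: ab; apply: dvdr_trans da.
Qed.

End Divisibility.

Lemma gcd_domain_field (K : fieldType) : gcd_domain K.
Proof.
move=> a b; have [[-> ->]|ab] : (a = 0 /\ b = 0) \/ (a != 0 \/ b != 0).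
- by have [->|] := eqVneq a 0; [have [->|] := eqVneq b 0|]; auto.
- by exists 0; split=> //; apply: dvdr0.
- have dv (d c : K) : d != 0 -> dvdr d c.
    by move=> d0; exists (c / d); rewrite divfK.
  exists 1; split; try exact/dv/oner_neq0.
  move=> e ea eb; apply: dv; apply: contra_notN (_ : ~ (a = 0 /\ b = 0)).
    by move=> /eqP e0; rewrite e0 in ea eb; split; apply: dvd0r.
  by case=> a0 b0; case: ab; rewrite ?a0 ?b0 eqxx.
Qed.

Lemma gcd_domain_iso (R S : idomainType) (f : {rmorphism R -> S}) :
  injective f -> (forall y, exists x, y = f x) -> gcd_domain S -> gcd_domain R.
Proof.
move=> inj surj gcdS.
have fdvd a b : dvdr (f a) (f b) <-> dvdr a b.
  split=> [[c]|[c ->]]; last by exists (f c); rewrite rmorphM.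
  by have [c' ->] := surj c; rewrite -rmorphM => /inj ->; exists c'.
move=> a b; have [d] := gcdS (f a) (f b); have [d' ->] := surj d.
move=> [/fdvd da /fdvd db dP]; exists d'; split=> // e /fdvd ea /fdvd eb.
exact/fdvd/dP.
Qed.

Section PolyGcd.
Variable R : idomainType.
Implicit Types (f g h : {poly R}) (c d : R).

Lemma dvdr_polyC c f : dvdr c%:P f <-> forall i, dvdr c f`_i.
Proof.
split=> [[g ->] i|cf]; first by exists g`_i; rewrite coefMC.
suff [g gE] : exists g : {poly R}, forall i, f`_i = g`_i * c.
  by exists g; apply/polyP => i; rewrite coefMC.
have: forall k, exists g : {poly R}, forall i, (i < k)%N -> f`_i = g`_i * c.
  elim=> [|k [g gE]]; first by exists 0.
  have [u uE] := cf k; exists (\poly_(i < k.+1) (if (i < k)%N then g`_i else u)).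
  move=> i ik; rewrite coef_poly ik; case: ltnP => [/gE //|ki].
  by have -> : i = k by apply/eqP; rewrite eqn_leq ki -ltnS ik.
move=> /(_ (size f)) [g gE]; exists (\poly_(i < size f) g`_i) => i.
by rewrite coef_poly; case: ltnP => [/gE //|/(nth_default 0) ->]; rewrite mul0r.
Qed.

Lemma gcd_one_poly f : gcd_one f <->
  forall d, dvdr d%:P f -> d \is a GRing.unit.
Proof.
split=> f1 d df; apply: f1.
  by move=> a /(nthP 0)[i _ <-]; move/dvdr_polyC: df => /(_ i).
apply/dvdr_polyC => i; case: (ltnP i (size f)) => [fi|/(nth_default 0) ->].
  exact/df/mem_nth.
exact: dvdr0.
Qed.

Hypothesis gcdR : gcd_domain R.

Lemma content_factor f : f != 0 ->
  exists c g, [/\ f = g * c%:P, size g = size f & gcd_one g].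
Proof.
move=> f0; have [|c [s [fE s1]]] := @gcd_one_factor _ gcdR f.
  by rewrite -size_eq0 size_poly_eq0.
have c0 : c != 0.
  apply: contraNneq f0 => c0; apply/eqP/polyP => i.
  have [fi|fi] := ltnP i (size f); last by rewrite coef0 nth_default.
  by move: fi; rewrite fE size_map => fi; rewrite (nth_map 0) // c0 mulr0 coef0.
have szs : size s = size f by rewrite fE size_map.
have lasts : last 1 s != 0.
  have := f0; rewrite -lead_coef_eq0 lead_coefE fE size_map.
  case: (s) szs => [|x s' _]; first by rewrite nth_nil eqxx.
  rewrite (nth_map 0) // mulf_eq0 negb_or => /andP[+ _].
  by rewrite -nth_last (set_nth_default 0).
have gE := PolyK lasts; exists c, (Poly s); split; last by rewrite gE.
  apply/polyP => i; rewrite coefMC gE.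
  case: (ltnP i (size s)) => si; first by rewrite fE (nth_map 0).
  by rewrite !nth_default ?mul0r ?fE ?size_map.
by rewrite gE szs.
Qed.

Lemma dvdr_polyCM c f (g : R) : gcd_one f -> dvdr c%:P (f * g%:P) -> dvdr c g.
Proof.
move=> f1 /dvdr_polyC cfg; apply: (euclid_seq gcdR f1) => b /(nthP 0)[i _ <-].
by have := cfg i; rewrite coefMC.
Qed.

(** Induction on the total size replaces reduction modulo a prime. If [d] divides f g and the
    leading coefficient of f, it divides t g, where t is f without its leading term; by induction it
    divides the content of t, hence f, and is a unit. So any [d] dividing f g is coprime to the
    leading coefficient of f, hence divides that of g, and is a unit by the same claim. *)
Lemma gauss f g : gcd_one f -> gcd_one g -> gcd_one (f * g).
Proof.
move: {2}(_ + _)%N (leqnn (size f + size g)%N) => k.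
elim: k f g => [|k IHk] f g.
  rewrite leqn0 addn_eq0 !size_poly_eq0 => /andP[/eqP -> /eqP ->].
  by rewrite mulr0.
(* The part of d common with the leading coefficient of f divides f. *)
have main h h' : (size h + size h' <= k.+1)%N -> gcd_one h -> gcd_one h' ->
    forall d, dvdr d%:P (h * h') -> dvdr d (lead_coef h) ->
    d \is a GRing.unit.
  move=> sz h1 h'1 d dhh dl.
  have [h0|h0] := eqVneq h 0.
    by apply: (h1) => a; rewrite h0 polyseq0.
  pose t := h - (lead_coef h)%:P * 'X^((size h).-1).
  have hE : h = t + (lead_coef h)%:P * 'X^((size h).-1) by rewrite subrK.
  have dt : dvdr d%:P (t * h').
    rewrite mulrBl; apply: dvdrB => //; rewrite -mulrA; apply: dvdr_mulr.
    by have [u ->] := dl; exists u%:P; rewrite polyCM.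
  suff dvt : dvdr d%:P t.
    move/gcd_one_poly: h1; apply; rewrite hE; apply: dvdrD => //.
    by apply: dvdr_mulr; have [u ->] := dl; exists u%:P; rewrite polyCM.
  have [->|t0] := eqVneq t 0; first exact: dvdr0.
  have [c [t' [tE szt t'1]]] := content_factor t0.
  have szlt : (size t < size h)%N.
    have szh : (0 < size h)%N by rewrite lt0n size_poly_eq0.
    rewrite -(prednK szh) ltnS; apply/leq_sizeP => j hj.
    rewrite coefB coefCM coefXn; move: hj; rewrite leq_eqVlt => /orP[/eqP <-|hj].
      by rewrite eqxx mulr1 lead_coefE subrr.
    rewrite gtn_eqF // mulr0 subr0 nth_default //.
    by rewrite -(prednK szh).
  have th1 : gcd_one (t' * h').
    apply: IHk => //; rewrite szt -ltnS (leq_trans _ sz) //.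
    by rewrite -addSn leq_add2r.
  rewrite tE; apply: dvdr_mull.
  have [u ->] : dvdr d c.
    by apply: dvdr_polyCM th1 _; rewrite mulrAC -tE.
  by exists u%:P; rewrite polyCM.
move=> sz f1 g1; apply/gcd_one_poly => d dfg.
have dl : dvdr d (lead_coef f * lead_coef g).
  by move/dvdr_polyC: (dfg) => /(_ (size (f * g)).-1); rewrite -lead_coefE lead_coefM.
have dco h h' : (size h + size h' <= k.+1)%N -> gcd_one h -> gcd_one h' ->
    dvdr d%:P (h * h') -> gcd_one [:: d; lead_coef h].
  move=> hsz h1 h'1 dhh; apply/gcd_one2 => e [u dE]; apply: (main h h') => //.
  by apply: dvdr_trans dhh; exists u%:P; rewrite dE polyCM.
have dg : dvdr d (lead_coef g) by apply: (euclid gcdR) dl; apply: (dco f g).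
apply: (main g f) dg => //; first by rewrite addnC.
by rewrite mulrC.
Qed.

Lemma dvdr_primitive c f g : gcd_one f -> dvdr c%:P (f * g) -> dvdr c%:P g.
Proof.
move=> f1 cfg; have [->|g0] := eqVneq g 0; first exact: dvdr0.
have [d [g' [gE _ g'1]]] := content_factor g0.
rewrite gE; apply: dvdr_mull.
have [u ->] : dvdr c d.
  by apply: dvdr_polyCM (gauss f1 g'1) _; rewrite -mulrA -gE.
by exists u%:P; rewrite polyCM.
Qed.

(** Pseudo-division gives [c *: g = q * f]; as [f] is primitive, [c] divides [q] and cancels. *)
Lemma dvdp_primitive f g : gcd_one f -> (f %| g)%R -> dvdr f g.
Proof.
move=> f1 /Pdiv.Idomain.dvdpP[[c q] /= c0 cE].
have [q' qE] : dvdr c%:P q.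
  by apply: dvdr_primitive f1 _; rewrite mulrC -cE -mul_polyC; exists g; rewrite mulrC.
exists q'; apply/(mulfI (_ : c%:P != 0)); first by rewrite polyC_eq0.
by rewrite mul_polyC cE qE mulrAC mulrC.
Qed.

Lemma dvdr_dvdp f g : dvdr f g -> (f %| g)%R.
Proof.
case=> h hE; apply/Pdiv.Idomain.dvdpP; exists (1, h); first exact: oner_neq0.
by rewrite /= scale1r.
Qed.

(** A gcd is the primitive part of the pseudo-gcd [gcdp] of the primitive parts, times a gcd of the
    contents. *)
Lemma gcd_domain_poly : gcd_domain {poly R}.
Proof.
move=> f g; have [->|f0] := eqVneq f 0.
  by exists g; split=> //; [exact: dvdr0 | exact: dvdr_refl].
have [->|g0] := eqVneq g 0.
  by exists f; split=> //; [exact: dvdr_refl | exact: dvdr0].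
have [c [f' [fE szf f1]]] := content_factor f0.
have [d [g' [gE szg g1]]] := content_factor g0.
have c0 : c%:P != 0 :> {poly R} by apply: contraNneq f0 => c0; rewrite fE c0 mulr0.
have d0 : d%:P != 0 :> {poly R} by apply: contraNneq g0 => c0'; rewrite gE c0' mulr0.
have [e [ec ed eP]] := gcdR c d.
have h0 : gcdp f' g' != 0.
  by rewrite gcdp_eq0 negb_and -size_poly_eq0 szf size_poly_eq0 f0.
have [k [h [hE szh h1]]] := content_factor h0.
have k0 : k != 0 by apply: contraNneq h0 => k0; rewrite hE k0 mulr0.
have hd : (h %| gcdp f' g')%R.
  by apply: dvdr_dvdp; rewrite hE; apply: dvdr_mulr (dvdr_refl _).
have dh : (gcdp f' g' %| h)%R by rewrite hE mulrC mul_polyC dvdpZl.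
have edvd x : dvdr e x -> dvdr e%:P x%:P.
  by case=> u ->; exists u%:P; rewrite polyCM.
have mul2 (a a' b b' : {poly R}) : dvdr a a' -> dvdr b b' -> dvdr (a * b) (a' * b').
  by move=> [u ->] [v ->]; exists (u * v); rewrite mulrACA.
move: hd; rewrite dvdp_gcd => /andP[hf hg].
exists (h * e%:P); split.
- by rewrite fE; apply: mul2 (edvd _ ec); apply: dvdp_primitive.
- by rewrite gE; apply: mul2 (edvd _ ed); apply: dvdp_primitive.
move=> p pf pg.
have p0 : p != 0 by apply: contraNneq f0 => p0; rewrite p0 in pf; exact/eqP/dvd0r.
have [b [p' [pE szp p1]]] := content_factor p0; rewrite pE.
have bp : dvdr b%:P p by rewrite pE; apply: dvdr_mull (dvdr_refl _).
have p'p : dvdr p' p by rewrite pE; apply: dvdr_mulr (dvdr_refl _).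
apply: mul2.
  apply: dvdp_primitive => //; apply: dvdp_trans dh.
  rewrite dvdp_gcd; apply/andP; split.
    move: (dvdr_dvdp (dvdr_trans p'p pf)); rewrite fE mulrC mul_polyC dvdpZr //.
    by rewrite polyC_eq0 in c0.
  move: (dvdr_dvdp (dvdr_trans p'p pg)); rewrite gE mulrC mul_polyC dvdpZr //.
  by rewrite polyC_eq0 in d0.
have [u ->] : dvdr b e.
  apply: eP; [apply: dvdr_polyCM f1 _; rewrite -fE |
              apply: dvdr_polyCM g1 _; rewrite -gE].
    exact: dvdr_trans pf.
  exact: dvdr_trans pg.
by exists u%:P; rewrite polyCM.
Qed.

End PolyGcd.

Lemma mpoly_rmorph_ext (R S : nzRingType) (n : nat)
    (f g : {rmorphism {mpoly R[n]} -> S}) :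
  (forall c, f c%:MP = g c%:MP) -> (forall i, f 'X_i = g 'X_i) -> f =1 g.
Proof.
move=> fgC fgX p; rewrite [p]mpolyE !raddf_sum; apply: eq_bigr => m _ /=.
rewrite -mul_mpolyC !rmorphM fgC mpolyXE_id !rmorph_prod; congr (_ * _).
by apply: eq_bigr => i _; rewrite !rmorphXn fgX.
Qed.

(** Induction on [n] along the isomorphism [muni] from [{mpoly R[n.+1]}] to [{poly {mpoly R[n]}}],
    with inverse [back]. *)
Lemma gcd_domain_mpoly (R : idomainType) (n : nat) :
  gcd_domain R -> gcd_domain {mpoly R[n]}.
Proof.
move=> gcdR; elim: n => [|n IHn].
  apply: (@gcd_domain_iso _ _ (@mcoeff 0 R 0%MM)) => // [|c]; last first.
    by exists c%:MP; rewrite /= mcoeffC eqxx mulr1.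
  move=> p q pq; apply/mpolyP => m; have -> // : m = 0%MM.
  by apply/mnmP => -[].
have Xw i : muni 'X_(widen_ord (leqnSn n) i) = ('X_i)%:P :> {poly {mpoly R[n]}}.
  rewrite muniE msuppX big_seq1 mcoeffX eqxx scale1r.
  have -> : U_(widen_ord (leqnSn n) i)%MM ord_max = 0%N.
    by rewrite mnm1E -val_eqE /= ltn_eqF.
  rewrite expr0 alg_polyC; congr ('X_[_])%:P.
  by apply/mnmP => j; rewrite mnmE !mnm1E -!val_eqE.
have Xm : muni 'X_ord_max = 'X :> {poly {mpoly R[n]}}.
  rewrite muniE msuppX big_seq1 mcoeffX eqxx scale1r mnm1E eqxx expr1.
  rewrite -[RHS]scale1r -mpolyX0; congr ('X_[_] *: _).
  by apply/mnmP => j; rewrite mnmE mnm1E mnmE -val_eqE /= gtn_eqF.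
pose back (q : {poly {mpoly R[n]}}) : {mpoly R[n.+1]} :=
  (map_poly (@mwiden n R) q).['X_ord_max].
pose f : {rmorphism {mpoly R[n.+1]} -> {poly {mpoly R[n]}}} := @muni n R.
suff [inj surj] : injective f /\ forall q, exists p, q = f p.
  exact: gcd_domain_iso inj surj (gcd_domain_poly IHn).
split=> [|q].
  apply: (can_inj (g := back)) => p.
  pose F := (horner_eval ('X_ord_max : {mpoly R[n.+1]}) \o
    map_poly (@mwiden n R)) \o @muni n R.
  have: (F : {rmorphism _ -> _}) =1 idfun; last exact.
  apply: mpoly_rmorph_ext => [c|i]; rewrite /F /= /horner_eval.
    by rewrite muniC map_polyC hornerC /= mwidenC.
  case: (unliftP ord_max i) => [j ->|->]; last by rewrite Xm map_polyX hornerX.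
  have -> : lift ord_max j = widen_ord (leqnSn n) j.
    by apply: val_inj; rewrite /= /bump leqNgt ltn_ord.
  by rewrite Xw map_polyC hornerC /= /mwiden mmapX mmap1U.
have rC (c : {mpoly R[n]}) : exists p, c%:P = f p.
  elim/mpolyind: c => [|c m p _ _ [p' pE]]; first by exists 0; rewrite rmorph0.
  have [x xE] : exists x, ('X_[m])%:P = f x.
    rewrite mpolyXE_id rmorph_prod.
    exists (\prod_i 'X_(widen_ord (leqnSn n) i) ^+ m i).
    by rewrite rmorph_prod; apply: eq_bigr => i _; rewrite !rmorphXn /= Xw.
  exists (c%:MP * x + p'); rewrite [RHS]rmorphD rmorphM -xE -pE /= muniC.
  by rewrite -polyCM -polyCD mul_mpolyC.
elim/poly_ind: q => [|q c [p ->]]; first by exists 0; rewrite rmorph0.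
have [p' ->] := rC c; exists (p * 'X_ord_max + p').
by rewrite [RHS]rmorphD rmorphM /= Xm.
Qed.

(** The denominator-free form of q^N G(p/q), for [N] at least the degree of [G]. *)
Definition homogenize (R : nzRingType) (G : {poly R}) (N : nat) (p q : R) : R :=
  \sum_(i < N.+1) G`_i * p ^+ i * q ^+ (N - i).

Lemma homogenizeE (R : nzRingType) (F : fieldType) (phi : {rmorphism R -> F})
    (G : {poly R}) (N : nat) (p q : R) :
  phi q != 0 -> (size G <= N.+1)%N ->
  phi (homogenize G N p q) =
    phi q ^+ N * (map_poly phi G).[phi p / phi q].
Proof.
move=> q0 sG; rewrite rmorph_sum (horner_coef_wide _ (n := N.+1)); last first.
  by apply: leq_trans sG; apply: size_poly.
rewrite mulr_sumr; apply: eq_bigr => i _.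
rewrite !rmorphM !rmorphXn coef_map expr_div_n /= mulrCA -mulrA; congr (_ * _).
rewrite mulrCA; congr (_ * _); rewrite expfB_cond //.
by rewrite (negPf q0) -ltnS ltn_ord.
Qed.

(** * Linear factors from roots p/q, and degree bounds *)

Section RootFactor.
Variables (R : idomainType) (F : fieldType) (phi : {rmorphism R -> F}).
Hypotheses (gcdR : gcd_domain R) (phi_inj : injective phi).

(** Clearing denominators in G(p/q) = 0 shows that [q] divides [p ^+ k.+1 * l], hence the leading
    coefficient [l]. A multiple of q X - p then cancels the leading term, and the size drops. *)
Lemma root_factor (p q : R) (G : {poly R}) :
  gcd_one [:: p; q] -> q != 0 ->
  (map_poly phi G).[phi p / phi q] = 0 -> dvdr (q%:P * 'X - p%:P) G.
Proof.
move=> pq q0; have fq0 : phi q != 0 by rewrite -(rmorph0 phi) (inj_eq phi_inj).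
move: {2}(size G) (leqnn (size G)) => k; elim: k G => [|k IHk] G.
  by rewrite leqn0 size_poly_eq0 => /eqP -> _; apply: dvdr0.
rewrite leq_eqVlt => /predU1P[sG|]; last exact: IHk.
move=> Gr; case: k IHk sG => [|k] IHk sG.
  have GE := size1_polyC (eq_leq sG); move: Gr sG; rewrite GE map_polyC hornerC.
  move=> /eqP; rewrite -(rmorph0 phi) (inj_eq phi_inj) => /eqP ->.
  by rewrite size_poly0.
pose l := lead_coef G; pose G1 := G - l%:P * 'X^(k.+1).
have sG1 : (size G1 <= k.+1)%N.
  apply/leq_sizeP => j kj; rewrite coefB coefCM coefXn.
  move: kj; rewrite leq_eqVlt => /predU1P[<-|kj].
    by rewrite eqxx mulr1 /l lead_coefE sG subrr.
  by rewrite (gtn_eqF kj) mulr0 subr0 nth_default // sG.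
have ql : dvdr q (p ^+ k.+1 * l).
  exists (- homogenize G1 k p q); apply: phi_inj.
  have -> : phi (p ^+ k.+1 * l) = phi l * (phi p / phi q) ^+ k.+1 * phi q ^+ k.+1.
    by rewrite rmorphM rmorphXn expr_div_n -!mulrA mulVf ?expf_neq0 // mulr1 mulrC.
  rewrite [RHS]rmorphM rmorphN (homogenizeE _ fq0 sG1).
  have -> : (map_poly phi G1).[phi p / phi q] = - (phi l * (phi p / phi q) ^+ k.+1).
    by rewrite rmorphB hornerD Gr hornerN rmorphM /= map_polyC map_polyXn !hornerE.
  by rewrite mulrN opprK; set a := phi l * _; rewrite exprSr mulrCA mulrA.
have [u lE] : dvdr q l.
  by apply: (euclid gcdR) ql; apply: (gcd_oneX gcdR); apply: gcd_one2C.
pose d := q%:P * 'X - p%:P; rewrite -/d.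
have droot : (map_poly phi d).[phi p / phi q] = 0.
  rewrite rmorphB rmorphM /= !map_polyC map_polyX.
  rewrite hornerD hornerN hornerM !hornerC hornerX.
  by rewrite mulrC divfK ?subrr.
have -> : G = (G1 + u%:P * p%:P * 'X^k) + (u%:P * 'X^k) * d.
  by rewrite /G1 lE /d polyCM exprS; ring.
apply: dvdrD; last by apply: dvdr_mull (dvdr_refl _).
apply: IHk.
  apply: (leq_trans (size_polyD _ _)); rewrite geq_max sG1 -polyCM mul_polyC.
  by rewrite (leq_trans (size_scale_leq _ _)) // size_polyXn.
have : (map_poly phi G).[phi p / phi q] = 0 by [].
have {1}-> : G = (G1 + u%:P * p%:P * 'X^k) + (u%:P * 'X^k) * d.
  by rewrite /G1 lE /d polyCM exprS; ring.
by rewrite rmorphD [X in _ + X]rmorphM hornerD [X in _ + X]hornerM droot mulr0 addr0.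
Qed.

End RootFactor.

Section Msize.
Variables (R : nzRingType) (n : nat).
Implicit Types p q : {mpoly R[n]}.

Lemma msize_leP p B :
  reflect (forall m, (B <= mdeg m)%N -> p@_m = 0) (msize p <= B)%N.
Proof.
apply: (iffP idP) => [pB m Bm|pB].
  by apply/memN_msupp_eq0/msize_mdeg_ge/(leq_trans pB).
have [->|p0] := eqVneq p 0; first by rewrite msize0.
rewrite -(mlead_deg p0) ltnNge; apply/negP => /pB /eqP.
by rewrite mleadc_eq0 (negPf p0).
Qed.

End Msize.

Lemma coef0_linear (R : nzRingType) (p q : R) : (q%:P * 'X - p%:P)`_0 = - p.
Proof. by rewrite coefB coefMX !coefC /= sub0r. Qed.

Lemma coef1_linear (R : nzRingType) (p q : R) : (q%:P * 'X - p%:P)`_1 = q.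
Proof. by rewrite coefB coefMX !coefC /= subr0. Qed.

Section SwapPoly.
Variables (R : idomainType) (n : nat).
Implicit Types G : {poly {mpoly R[n]}}.

(** The identification of R[x][y] with R[y][x], after which [msize] measures the degree in x. *)
Definition swap_poly : {poly {mpoly R[n]}} -> {mpoly {poly R}[n]} :=
  horner_eval ('X)%:MP \o map_poly (map_mpoly polyC).

HB.instance Definition _ := GRing.RMorphism.on swap_poly.

Lemma coef_swap_poly G m k : ((swap_poly G)@_m)`_k = (G`_k)@_m.
Proof.
rewrite /swap_poly /= /horner_eval.
rewrite (horner_coef_wide _ (size_poly _ _)) raddf_sum coef_sum.
transitivity (\sum_(i < size G) (G`_i)@_m * (k == i :> nat)%:R).
  apply: eq_bigr => i _; rewrite coef_map /= -rmorphXn mulrC /= mcoeffCM.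
  by rewrite mcoeff_map_mpoly mulrC coefCM coefXn.
case: (ltnP k (size G)) => kG.
  rewrite (bigD1 (Ordinal kG)) //= eqxx mulr1 big1 ?addr0 // => i ik.
  rewrite (_ : k == i = false) ?mulr0 //.
  by apply: contraNF ik => /eqP ki; apply/eqP/val_inj.
rewrite big1 => [|i _]; first by rewrite nth_default // mcoeff0.
by rewrite gtn_eqF ?mulr0 // (leq_trans (ltn_ord i)).
Qed.

(* Comparing total degrees in the variables of [p] and [q]. *)
Lemma small_multiple_eq0 (p q : {mpoly R[n]}) G :
  dvdr (q%:P * 'X - p%:P) G ->
  (forall k, (msize G`_k < maxn (msize p) (msize q))%N) -> G = 0.
Proof.
set d := _ - _ => -[Q GE] szG; have [//|G0] := eqVneq G 0.
pose B := (maxn (msize p) (msize q)).-1.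
have B0 : (0 < maxn (msize p) (msize q))%N by apply: leq_trans (szG 0%N).
have inj0 P : P != 0 -> swap_poly P != 0.
  move=> P0; apply: contraNneq P0 => sP; apply/eqP/polyP => k; apply/mpolyP => m.
  by rewrite -coef_swap_poly sP mcoeff0 !coef0 mcoeff0.
have sGB : (msize (swap_poly G) <= B)%N.
  apply/msize_leP => m Bm; apply/polyP => k; rewrite coef_swap_poly coef0.
  move: Bm; apply/msize_leP: m.
  by rewrite -ltnS /B prednK.
have dB : (B < msize (swap_poly d))%N.
  rewrite /B prednK // geq_max; apply/andP; split; apply/msize_leP => m dm.
    have := coef_swap_poly d m 0; rewrite (memN_msupp_eq0 (msize_mdeg_ge dm)).
    have -> : d`_0 = - p by apply: coef0_linear.
    by rewrite mcoeffN => /eqP; rewrite coef0 eq_sym oppr_eq0 => /eqP.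
  have := coef_swap_poly d m 1; rewrite (memN_msupp_eq0 (msize_mdeg_ge dm)).
  have -> : d`_1 = q by apply: coef1_linear.
  by rewrite coef0.
have sG : swap_poly G = swap_poly Q * swap_poly d by rewrite GE rmorphM.
have [Q0 d0] : Q != 0 /\ d != 0.
  by split; apply: contraNneq G0 => e0; rewrite GE e0 ?mulr0 ?mul0r.
move: sGB; rewrite sG msizeM ?inj0 //.
move: dB; rewrite (mpolySpred _ (inj0 _ Q0)) addSn /= => dB.
by rewrite leqNgt (leq_trans dB) // leq_addl.
Qed.

End SwapPoly.

(** * Multivariate polynomials over fraction fields *)

Section MpolyDivisibility.
Variables (R : idomainType) (n : nat).
Implicit Types p q : {mpoly R[n]}.

Lemma dvdr_mpolyC (c : R) p : (forall m, dvdr c p@_m) -> dvdr c%:MP p.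
Proof.
move=> cp; rewrite [p]mpolyE; apply: dvdr_sum => m _.
by have [u ->] := cp m; exists (u *: 'X_[m]); rewrite [RHS]mulrC mul_mpolyC scalerA mulrC.
Qed.

Lemma coef_dvdr_mpolyC (c : R) p m : dvdr c%:MP p -> dvdr c p@_m.
Proof. by case=> q ->; exists q@_m; rewrite mulrC mcoeffCM mulrC. Qed.

Lemma dvdr_const (c : R) p : c != 0 -> dvdr p c%:MP -> exists d, p = d%:MP.
Proof.
move=> c0 [q cE]; have cp0 : c%:MP_[n] != 0 by rewrite mpolyC_eq0.
have [q0 p0] : q != 0 /\ p != 0.
  by split; apply: contraNneq cp0 => e0; rewrite cE e0 ?mulr0 ?mul0r.
have := congr1 (fun p => msize p) cE.
rewrite msizeC c0 msizeM // => sqp; exists p@_0; apply: msize1_polyC.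
move: sqp; rewrite (mpolySpred _ q0) (mpolySpred _ p0) addSn addnS /= => -[/esym/eqP].
by rewrite addn_eq0 => /andP[_ /eqP ->].
Qed.

Hypothesis gcdR : gcd_domain R.

(** A common divisor of [p] and a nonzero constant is itself constant, hence a unit because [p] has
    content 1; so [euclid] applies. *)
Lemma primitive_euclid (c : R) p q : c != 0 ->
  (forall d : R, dvdr d%:MP p -> d \is a GRing.unit) ->
  dvdr p (c%:MP * q) -> dvdr p q.
Proof.
move=> c0 p1; apply: euclid; first exact: gcd_domain_mpoly.
apply/gcd_one2 => d dp dc; have [e dE] := dvdr_const c0 dc.
by move: dp; rewrite dE => /p1 ue; exact: rmorph_unit.
Qed.

Lemma primitive_mpoly p : p != 0 -> exists (c : R) q,
  [/\ c != 0, p = c *: q & forall d, dvdr d%:MP q -> d \is a GRing.unit].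
Proof.
move=> p0; have [c [cs cP]] := gcd_seq gcdR [seq p@_m | m <- msupp p].
have cp m : dvdr c p@_m.
  have [mp|/memN_msupp_eq0 ->] := boolP (m \in msupp p); last exact: dvdr0.
  exact/cs/map_f.
have [q pE] := dvdr_mpolyC cp.
have c0 : c != 0 by apply: contraNneq p0 => c0; rewrite pE c0 mulr0.
exists c, q; split=> //; first by rewrite pE mulrC mul_mpolyC.
move=> d dq; have [u uE] : dvdr (d * c) c.
  apply: cP => _ /mapP[m _ ->]; rewrite pE [q * _]mulrC mcoeffCM [c * _]mulrC.
  by have [v ->] := coef_dvdr_mpolyC m dq; exists v; rewrite mulrA.
have /(mulIf c0) uE1 : 1 * c = (u * d) * c by rewrite mul1r -mulrA.
by apply: (@dvdr_unit _ _ 1); [rewrite unitr1 | exists u].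
Qed.

End MpolyDivisibility.

Lemma mpoly_image (R S : nzRingType) (n : nat) (f : {rmorphism R -> S})
    (p : {mpoly S[n]}) :
  (forall m, exists c, p@_m = f c) -> exists q, p = map_mpoly f q.
Proof.
move=> pf; rewrite [p]mpolyE; elim/big_ind: _.
- by exists 0; rewrite rmorph0.
- by move=> _ _ [q1 ->] [q2 ->]; exists (q1 + q2); rewrite rmorphD.
move=> m _; have [c ->] := pf m; exists (c *: 'X_[m]).
apply/mpolyP => k; rewrite mcoeff_map_mpoly !mcoeffZ !mcoeffX.
have fE : f (c * (m == k)%:R) = f c * (m == k)%:R by rewrite rmorphM rmorph_nat.
exact: esym fE.
Qed.

Lemma fractionP (R : idomainType) (x : {fraction R}) :
  exists a b : R, b != 0 /\ x = FracField.tofrac a / FracField.tofrac b.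
Proof.
set u := \n_(repr x); set v := \d_(repr x).
have v0 : v != 0 by exact: denom_ratioP.
exists u, v; split=> //; apply: (canRL (mulfK _)); first by rewrite tofrac_eq0.
rewrite -[LHS]/(FracField.mul x (FracField.tofrac v)).
rewrite -[RHS]/(FracField.tofrac u) -[x]reprK !piE.
apply/eqmodP; rewrite /= FracField.equivfE /FracField.mulf.
rewrite !numden_Ratio ?mulr1 ?oner_eq0 ?mulf_neq0 ?oner_neq0 //.
by rewrite -/u -/v mulrC.
Qed.

Lemma clear_denominators (R : idomainType) (F : fieldType)
    (phi : {rmorphism R -> F}) (n : nat) (p : {mpoly F[n]}) :
  injective phi -> (forall x, exists a b, b != 0 /\ x = phi a / phi b) ->
  exists (c : R) (q : {mpoly R[n]}), c != 0 /\ map_mpoly phi q = phi c *: p.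
Proof.
move=> inj frac; rewrite [p]mpolyE; elim/big_ind: _.
- by exists 1, 0; rewrite oner_neq0 rmorph0 scaler0.
- move=> x y [c [q [c0 qE]]] [d [r [d0 rE]]].
  exists (c * d), (d *: q + c *: r); rewrite mulf_neq0 //; split=> //.
  rewrite rmorphD /= !map_mpolyZ /= qE rE !scalerA scalerDr -!rmorphM.
  by rewrite [d * c]mulrC.
move=> m _; have [a [b [b0 ->]]] := frac p@_m.
exists b, (a *: 'X_[m]); split=> //; rewrite map_mpolyZ map_mpolyX scalerA.
by rewrite mulrC divfK // -(rmorph0 phi) (inj_eq inj).
Qed.

Section PrimeFactor.
Variables (L E : fieldType) (n : nat) (psi : {rmorphism {mpoly L[n]} -> E}).

Lemma msize1_unit (p : {mpoly L[n]}) : msize p = 1 -> p \is a GRing.unit.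
Proof.
by move/eqP/msize_poly1P => [c c0 ->]; rewrite (rmorph_unit (@mpolyC n L)) // unitfE.
Qed.

(** Take a divisor of [D] in the kernel of [psi] none of whose divisors of smaller degree lies in
    the kernel. Since [psi] maps to a field, one factor in any factorization of it already vanishes,
    so the other is a unit; and irreducible elements of a GCD domain are prime. *)
Lemma prime_factor (D : {mpoly L[n]}) : D != 0 -> psi D = 0 ->
  exists m, [/\ m != 0, psi m = 0, dvdr m D &
    forall X Y, dvdr m (X * Y) -> dvdr m X \/ dvdr m Y].
Proof.
have gcdL : gcd_domain {mpoly L[n]} by apply/gcd_domain_mpoly/gcd_domain_field.
move: {2}(msize D) (leqnn (msize D)) => k.
elim: k D => [|k IHk] D sD D0 psiD.
  by move: sD; rewrite leqn0 msize_poly_eq0 (negPf D0).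
have [[D1 [D1D psiD1 sD1]]|min] := boolp.EM (exists D1,
    [/\ dvdr D1 D, psi D1 = 0 & (msize D1 < msize D)%N]).
  have D10 : D1 != 0.
    by apply: contraNneq D0 => D10; rewrite D10 in D1D; exact/eqP/dvd0r.
  have [|m [m0 psim mD1 mP]] := IHk D1 _ D10 psiD1; first exact: leq_trans sD1 sD.
  by exists m; split=> //; apply: dvdr_trans D1D.
exists D; split=> //; first exact: dvdr_refl.
(* No proper factor of D vanishes under psi, so gcd(D, X) is 1 or D. *)
have cofactor D1 D2 : D = D1 * D2 -> psi D1 = 0 -> D2 \is a GRing.unit.
  move=> DE psiD1; apply: msize1_unit.
  have [D10 D20] : D1 != 0 /\ D2 != 0.
    by split; apply: contraNneq D0 => e0; rewrite DE e0 ?mulr0 ?mul0r.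
  have : ~~ (msize D1 < msize D)%N.
    by apply/negP => lt; apply: min; exists D1; split=> //; exists D2; rewrite mulrC.
  rewrite -leqNgt DE msizeM // (mpolySpred _ D10) (mpolySpred _ D20) addSn addnS /=.
  by rewrite ltnS -{2}[(msize D1).-1]addn0 leq_add2l leqn0 => /eqP ->.
move=> X Y DXY; have [d [D' [X' [DE XE DX']]]] := gcd_factor2 gcdL D X.
have /eqP : psi D' * psi d = 0 by rewrite -rmorphM -DE.
rewrite mulf_eq0 => /orP[/eqP psiD'|/eqP psid].
  right; apply: (euclid gcdL) DXY; apply/gcd_one2 => e eD eX.
  have ud := cofactor _ _ DE psiD'.
  have strip (Z Z' : {mpoly L[n]}) : Z = Z' * d -> dvdr e Z -> dvdr e Z'.
    by move=> -> [w wE]; exists (w * d^-1); rewrite -[Z'](mulrK ud) wE mulrAC.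
  move/gcd_one2: DX'; apply; [exact: strip DE eD|exact: strip XE eX].
left; have uD' : D' \is a GRing.unit by apply: (cofactor d D') psid; rewrite DE mulrC.
by exists (X' * D'^-1); rewrite DE XE mulrA mulrVK.
Qed.

End PrimeFactor.

Section SwapMpoly.
Variables (R : idomainType) (n : nat).
Implicit Types Q : {mpoly {mpoly R[n]}[n]}.

(** Exchanges the two sets of variables, so that [msize] of the image measures the degree in the
    coefficient variables. *)
Definition swap_mpoly : {mpoly {mpoly R[n]}[n]} -> {mpoly {mpoly R[n]}[n]} :=
  mmap (map_mpoly (@mpolyC n R)) (fun i => ('X_i)%:MP).

HB.instance Definition _ := GRing.RMorphism.on swap_mpoly.

Lemma mcoeff_swap_mpoly Q a b : ((swap_mpoly Q)@_b)@_a = (Q@_a)@_b.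
Proof.
rewrite {1}/swap_mpoly /mmap !raddf_sum /=.
transitivity (\sum_(m <- msupp Q) (Q@_m)@_b * (m == a)%:R).
  apply: eq_bigr => m _; have -> : mmap1 (fun i => ('X_i)%:MP) m = ('X_[m])%:MP
      :> {mpoly {mpoly R[n]}[n]}.
    by rewrite [in RHS]mpolyXE_id rmorph_prod; apply: eq_bigr => i _; rewrite rmorphXn.
  by rewrite mulrC mcoeffCM mcoeff_map_mpoly mulrC mcoeffCM mcoeffX.
have [aQ|aQ] := boolP (a \in msupp Q).
  rewrite (bigD1_seq a) //= eqxx mulr1 big1 ?addr0 // => m ma.
  by rewrite (negPf ma) mulr0.
rewrite (memN_msupp_eq0 aQ) mcoeff0 big_seq big1 // => m mQ.
by rewrite (_ : m == a = false) ?mulr0 //; apply: contraNF aQ => /eqP <-.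
Qed.

Lemma swap_mpoly_eq0 Q : (swap_mpoly Q == 0) = (Q == 0).
Proof.
apply/eqP/eqP => [sQ|->]; last by rewrite rmorph0.
by apply/mpolyP => a; apply/mpolyP => b; rewrite -mcoeff_swap_mpoly sQ !mcoeff0.
Qed.

End SwapMpoly.

(* The quotient of [a - w b] by [M] has its coefficients in [F + w F], and its *)
(* component along [w] is a quotient of [b] by [M].                            *)
Lemma linear_disjoint_dvdr (E : fieldType) (n : nat) (F : E -> Prop)
    (M a b N : {mpoly E[n]}) (w : E) :
  (forall x y, F x -> F y -> F (x - y)) ->
  (forall x y, F x -> F y -> F (x * y)) ->
  (forall x y, F x -> F y -> F (x / y)) ->
  M != 0 -> (forall m, F M@_m) -> (forall m, F a@_m) -> (forall m, F b@_m) ->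
  ~ F w -> a - w *: b = N * M -> dvdr M b.
Proof.
move=> FB FM FV M0 FMc; have F0 : F 0 by rewrite -(subrr M@_0); apply: FB.
have coef0 x y : F x -> F y -> ~ F w -> x - w * y = 0 -> y = 0.
  move=> Fx Fy Fw /eqP; rewrite subr_eq0 => /eqP xE; apply/eqP; apply/negP => /negP y0.
  by apply: Fw; rewrite -(mulfK y0 w) -xE; apply: FV.
have base a' b' : (forall m, F a'@_m) -> (forall m, F b'@_m) -> ~ F w ->
    a' - w *: b' = 0 -> dvdr M b'.
  move=> Fa Fb Fw ab; suff -> : b' = 0 by exact: dvdr0.
  apply/mpolyP => m; rewrite mcoeff0; apply: (coef0 a'@_m) => //.
  by rewrite -mcoeffZ -mcoeffB ab mcoeff0.
elim/mleadrect: N a b => N IHN a b Fa Fb Fw abE.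
have [N0|N0] := eqVneq N 0; first by apply: base Fa Fb Fw _; rewrite abE N0 mul0r.
pose al := (mlead N + mlead M)%MM; pose x := a@_al / mleadc M; pose y := b@_al / mleadc M.
have lM0 : mleadc M != 0 by rewrite mleadc_eq0.
(* The leading coefficient of [N] splits into a part in [F] and [w] times a part in [F]. Moving
   these parts into [a] and [b] lowers the leading monomial of the quotient. *)
have NE : mleadc N = x - w * y.
  apply: (mulIf lM0); rewrite -mleadcM -abE mcoeffB mcoeffZ mulrBl /x divfK //.
  by rewrite -mulrA /y divfK.
pose t := 'X_[mlead N] * M.
have Ft c m : F c -> F (c *: t)@_m.
  move=> Fc; rewrite mcoeffZ; apply: (FM) => //; rewrite /t mulrC.
  have [le|nle] := boolP (mlead N <= m)%MM.
    by rewrite -(submK le) addmC mcoeffMX.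
  rewrite memN_msupp_eq0 // (perm_mem (msuppMX _ _)); apply: contra nle => /mapP[k _ ->].
  exact: lem_addr.
have FC (c : E) p m : F c -> (forall m, F p@_m) -> F (p - c *: t)@_m.
  by move=> Fc Fp; rewrite mcoeffB; apply: FB => //; apply: Ft.
have Fx : F x by apply: FV.
have Fy : F y by apply: FV.
pose N' := N - mleadc N *: 'X_[mlead N].
have abE' : (a - x *: t) - w *: (b - y *: t) = N' * M.
  rewrite mulrBl -abE NE -scalerAl -/t scalerBl scalerBr scalerA.
  ring.
suff [u bE] : dvdr M (b - y *: t).
  by exists (u + y *: 'X_[mlead N]); rewrite mulrDl -bE -scalerAl subrK.
have [N'0|N'0] := eqVneq N' 0.
  apply: (base (a - x *: t)) => //; try by move=> m; apply: FC.
  by rewrite abE' N'0 mul0r.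
apply: (IHN N') abE' => //; try by move=> m; apply: FC.
exact: ltm_mleadD.
Qed.

Lemma homogenize_rmorph (R S : nzRingType) (f : {rmorphism R -> S})
    (G : {poly R}) N p q :
  f (homogenize G N p q) = homogenize (map_poly f G) N (f p) (f q).
Proof.
rewrite rmorph_sum; apply: eq_bigr => i _.
by rewrite !rmorphM !rmorphXn coef_map.
Qed.

Lemma homogenizeM (R : idomainType) (A B : {poly R}) (M N : nat) (p q : R) :
  q != 0 -> (size A <= M.+1)%N -> (size B <= N.+1)%N ->
  homogenize (A * B) (M + N) p q = homogenize A M p q * homogenize B N p q.
Proof.
move=> q0 sA sB; apply/eqP; rewrite -tofrac_eq tofracM; apply/eqP.
have fq0 : FracField.tofrac q != 0 by rewrite tofrac_eq0.
rewrite !(homogenizeE (phi := @FracField.tofrac R)) //; last first.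
  have [->|A0] := eqVneq A 0; first by rewrite mul0r size_poly0.
  have [->|B0] := eqVneq B 0; first by rewrite mulr0 size_poly0.
  rewrite size_mul // -subn1 leq_subLR add1n -addnS -addSn.
  exact: leq_add.
by rewrite exprD rmorphM hornerM mulrACA.
Qed.

Lemma homogenizeM_map (R S : idomainType) (f : {rmorphism R -> S})
    (A B : {poly R}) (M N : nat) (p q : S) :
  q != 0 -> (size A <= M.+1)%N -> (size B <= N.+1)%N ->
  homogenize (map_poly f (A * B)) (M + N) p q =
    homogenize (map_poly f A) M p q * homogenize (map_poly f B) N p q.
Proof.
move=> q0 sA sB; rewrite rmorphM homogenizeM //.
  exact: leq_trans (size_poly _ _) sA.
exact: leq_trans (size_poly _ _) sB.
Qed.

Lemma gcd_domain_mpolyK (K : fieldType) (n : nat) : gcd_domain {mpoly K[n]}.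
Proof. exact/gcd_domain_mpoly/gcd_domain_field. Qed.

(** * Algebraic relations in the field K(x) *)

Section RationalFunctions.
Variables (K : fieldType) (n : nat) (E : fieldType).
Variable phi : {rmorphism {mpoly K[n]} -> E}.
Hypothesis phi_inj : injective phi.
Hypothesis phi_frac : forall x, exists a b, b != 0 /\ x = phi a / phi b.
Local Notation kappa := (phi \o @mpolyC n K).

Lemma phi_eq0 p : (phi p == 0) = (p == 0).
Proof. by rewrite -(rmorph0 phi) (inj_eq phi_inj). Qed.

Lemma reduced_fraction (r : E) : exists a b,
  [/\ b != 0, r = phi a / phi b & gcd_one [:: a; b]].
Proof.
have [a [b [b0 ->]]] := phi_frac r.
have [d [a' [b' [aE bE ab]]]] := gcd_factor2 (@gcd_domain_mpolyK K n) a b.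
have [d0 b'0] : d != 0 /\ b' != 0.
  by split; apply: contraNneq b0 => e0; rewrite bE e0 ?mulr0 ?mul0r.
exists a', b'; split=> //; rewrite aE bE !rmorphM.
by rewrite -mulf_div divff ?mulr1 // phi_eq0.
Qed.

(** A relation c(r) = 0 with r = a/b in lowest terms makes b X - a a divisor of [c], whose
    coefficients have degree 0 in x. This forces [c = 0] unless [a] and [b] are constants. *)
Lemma nonconstant_transcendental (r : E) (c : {poly K}) :
  (forall k, r <> kappa k) -> (map_poly kappa c).[r] = 0 -> c = 0.
Proof.
have [a [b [b0 rE ab]]] := reduced_fraction r; move=> rK cr.
have cd : dvdr (b%:P * 'X - a%:P) (map_poly (@mpolyC n K) c).
  apply: (root_factor (@gcd_domain_mpolyK K n) phi_inj) => //.
  by rewrite -map_poly_comp -rE.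
have sz k : (msize (map_poly (@mpolyC n K) c)`_k <= 1)%N.
  by rewrite coef_map /= msizeC; case: (_ != _).
have [lt|] := ltnP 1 (maxn (msize a) (msize b)).
  have c0 := small_multiple_eq0 cd (fun k => leq_ltn_trans (sz k) lt).
  apply/polyP => k; apply/eqP; rewrite coef0 -(mpolyC_eq0 n).
  by have := coef_map (@mpolyC n K) c k; rewrite c0 coef0 => <-.
rewrite geq_max => /andP[/msize1_polyC aE /msize1_polyC bE].
by case: (rK (a@_0 / b@_0)); rewrite fmorph_div rE aE bE /= !mcoeffC eqxx !mulr1.
Qed.

Section Luroth.
Variables (L : fieldType) (iota : {rmorphism K -> L}) (j : {rmorphism L -> E}).
Hypothesis j_iota : forall c, j (iota c) = kappa c.

Local Notation KL := (map_mpoly iota).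

(** Specialization of L[y] at the generic point y = x; on polynomials with coefficients in K it is
    [phi], hence injective there. *)
Definition generic_eval : {mpoly L[n]} -> E := mmap j (fun i => phi 'X_i).
HB.instance Definition _ := GRing.RMorphism.on generic_eval.
Local Notation psi := generic_eval.

Lemma generic_evalC w : psi w%:MP = j w. Proof. exact: mmapC. Qed.

Lemma generic_eval_map p : psi (KL p) = phi p.
Proof.
pose f : {rmorphism _ -> _} := psi \o KL.
have : f =1 phi; last exact.
apply: mpoly_rmorph_ext => [c|i]; rewrite /f /=.
  by rewrite map_mpolyC generic_evalC j_iota.
by rewrite map_mpolyX /psi mmapX mmap1U.
Qed.

Lemma map_mpoly_eq0 (p : {mpoly K[n]}) : (KL p == 0) = (p == 0).
Proof.
apply/eqP/eqP => [p0|->]; last exact: rmorph0.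
apply/mpolyP => m; apply: (fmorph_inj iota).
by rewrite -mcoeff_map_mpoly p0 !mcoeff0 rmorph0.
Qed.

Variable v : L.
Hypothesis v_transc : forall k, j v <> kappa k.
Hypothesis v_alg : forall w : L, exists P : {poly {poly K}},
  P != 0 /\ (map_poly (fun c : {poly K} => (map_poly kappa c).[j v]) P).[j w] = 0.

Variables (a b : {mpoly K[n]}) (m : {mpoly L[n]}).
Hypotheses (b0 : b != 0) (vE : j v = phi a / phi b) (ab : gcd_one [:: a; b]).
Hypotheses (psim : psi m = 0) (mD : dvdr m (KL a - v%:MP * KL b)).
Hypothesis m_prime : forall X Y, dvdr m (X * Y) -> dvdr m X \/ dvdr m Y.

(** Let P(v, w) = 0. As a polynomial in its first variable, f^M P(., e/f) has the root v = a/b, so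
    it is a multiple of b X - a. Renaming x to y and putting X = v, [m] divides f(y)^M P(v,
    e(y)/f(y)). Splitting P(v, .) as (X - w)^k times a factor Q with Q(w) nonzero, primality leaves
    [m] dividing e(y) - w f(y). *)
Lemma dvdr_relation (w : L) (e f : {mpoly K[n]}) : f != 0 ->
  j w = phi e / phi f -> dvdr m (KL e - w%:MP * KL f).
Proof.
move=> f0 wE; have [P [P0 Pvw]] := v_alg w.
pose evL : {rmorphism {poly K} -> L} := horner_eval v \o map_poly iota.
pose M := (size P).-1; pose Pv := map_poly evL P.
have evL_inj c : (evL c == 0) = (c == 0).
  apply/eqP/eqP => [c0|->]; last exact: rmorph0.
  apply: (nonconstant_transcendental v_transc).
  rewrite -(eq_map_poly j_iota) map_poly_comp horner_map /=.
  by move: c0; rewrite /evL /= /horner_eval => ->; rewrite rmorph0.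
have Pv0 : Pv != 0.
  by rewrite map_poly_eq0_id0 // evL_inj lead_coef_eq0.
have szP : (size P <= M.+1)%N by rewrite leqSpred.
have szPv : (size Pv <= M.+1)%N by apply: leq_trans (size_poly _ _) szP.
have jev c : j (evL c) = (map_poly kappa c).[j v].
  by rewrite -horner_map -map_poly_comp (eq_map_poly j_iota).
have Pvw0 : root Pv w.
  rewrite rootE -(fmorph_eq0 j) -horner_map -map_poly_comp.
  by rewrite (eq_map_poly jev) Pvw.
(* [g] is [P], homogenized in its second variable and evaluated there at e/f. *)
pose g : {poly {mpoly K[n]}} :=
  homogenize (map_poly (map_poly (@mpolyC n K)) P) M e%:P f%:P.
have gdvd : dvdr (b%:P * 'X - a%:P) g.
  apply: (root_factor (@gcd_domain_mpolyK K n) phi_inj) => //; rewrite -vE.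
  pose ev : {rmorphism {poly {mpoly K[n]}} -> E} :=
    horner_eval (j v) \o map_poly phi.
  have evC c : ev c%:P = phi c by rewrite /ev /= /horner_eval map_polyC hornerC.
  rewrite -[LHS]/(ev g) homogenizeE ?evC ?phi_eq0 //; last first.
    by apply: leq_trans (size_poly _ _) szP.
  rewrite -wE -map_poly_comp; apply/eqP; rewrite mulf_eq0; apply/orP; right.
  rewrite -Pvw; apply/eqP; congr (_.[_]); apply: eq_map_poly => c.
  by rewrite /ev /= /horner_eval -map_poly_comp.
(* [chi] renames x to y and puts [v] for the variable, so b X - a becomes the opposite of a(y) - v
   b(y), which [m] divides. *)
pose chi : {rmorphism {poly {mpoly K[n]}} -> {mpoly L[n]}} :=
  horner_eval v%:MP \o map_poly KL.
have chiC c : chi c%:P = KL c by rewrite /chi /= /horner_eval map_polyC hornerC.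
pose hom G N := homogenize (map_poly (@mpolyC n L) G) N (KL e) (KL f).
have chig : chi g = hom Pv M.
  rewrite homogenize_rmorph !chiC /hom; congr (homogenize _ _ _ _).
  rewrite /Pv -!map_poly_comp; apply: eq_map_poly => c /=.
  rewrite /horner_eval -[RHS]horner_map -!map_poly_comp.
  by congr (_.[_]); apply: eq_map_poly => x /=; rewrite map_mpolyC.
have mg : dvdr m (hom Pv M).
  rewrite -chig; case: gdvd => h ->; rewrite rmorphM; apply: dvdr_mull.
  rewrite rmorphB rmorphM !chiC /chi /= /horner_eval map_polyX hornerX -opprB.
  by rewrite mulrC; apply: dvdrN.
have KLf0 : KL f != 0 by rewrite map_mpoly_eq0.
have [k [Q +]] := multiplicity_XsubC Pv w; rewrite Pv0 /= => Qw PvE.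
have Q0 : Q != 0 by apply: contraNneq Qw => ->; rewrite root0.
have szQ : (size Pv = size Q + k)%N.
  rewrite PvE size_Mmonic ?monic_exp ?monicXsubC // size_exp_XsubC.
  by rewrite addnS.
have kM : (k <= M)%N.
  rewrite -ltnS (leq_trans _ szPv) // szQ -{1}[k]add0n ltn_add2r lt0n.
  by rewrite size_poly_eq0.
have homX l : hom (('X - w%:P) ^+ l) l = (KL e - w%:MP * KL f) ^+ l.
  elim: l => [|l IHl].
    by rewrite /hom /homogenize big_ord1 expr0 rmorph1 coef1 eqxx !expr0 !mulr1.
  rewrite !exprSr -IHl -addn1 /hom homogenizeM_map //.
  - congr (_ * _); rewrite rmorphB /= map_polyX map_polyC /homogenize.
    rewrite big_ord_recl big_ord1 /= !coefB !coefX !coefC /=.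
    have -> : bump 0 0 = 1%N by [].
    rewrite subn0 subnn sub0r subr0 !expr0 !expr1 !mulr1 mul1r mulNr addrC //.
  - by rewrite size_exp_XsubC.
  - by rewrite size_XsubC.
have szQM : (size Q <= (M - k).+1)%N.
  by rewrite -subSn // -(leq_add2r k) -szQ subnK // leqW.
have homPv : hom Pv M = hom Q (M - k)%N * hom (('X - w%:P) ^+ k) k.
  have szX : (size (('X - w%:P) ^+ k) <= k.+1)%N by rewrite size_exp_XsubC.
  have := homogenizeM_map (@mpolyC n L) (KL e) KLf0 szQM szX.
  by rewrite (subnK kM) -PvE; apply.
(* At y = x the factor coming from [Q] is a power of [f] times Q(w), which is nonzero, so [m] cannot
   divide it. *)
move: mg; rewrite homPv homX => /m_prime[[h hE]|].
  case/negP: Qw; rewrite rootE -(fmorph_eq0 j).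
  have /eqP : psi (hom Q (M - k)%N) = 0 by rewrite hE rmorphM /= psim mulr0.
  have psif : psi (KL f) != 0 by rewrite generic_eval_map phi_eq0.
  have sQ : (size (map_poly (@mpolyC n L) Q) <= (M - k).+1)%N.
    by apply: leq_trans (size_poly _ _) szQM.
  rewrite (homogenizeE (phi := psi) _ psif sQ) /= !generic_eval_map -wE mulf_eq0 expf_eq0.
  rewrite phi_eq0 (negPf f0) andbF /=.
  by rewrite -map_poly_comp (eq_map_poly generic_evalC) horner_map.
elim: k {Q Qw PvE Q0 szQ kM szQM homPv} => [|k IHk].
  rewrite expr0 => -[h hE].
  have psi1 : psi 1 = 1 := rmorph1 psi.
  by case/eqP: (oner_neq0 E); rewrite -psi1 hE rmorphM /= psim mulr0.
by rewrite exprS => /m_prime[].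
Qed.

End Luroth.
End RationalFunctions.

(** * Lüroth's theorem for subfields of transcendence degree one *)

Section SimpleExtension.
Variables (K E : fieldType) (kappa : {rmorphism K -> E}) (u : E).

Definition simple_ext (x : E) : Prop := exists P Q : {poly K},
  (map_poly kappa Q).[u] != 0 /\ x = (map_poly kappa P).[u] / (map_poly kappa Q).[u].

Let ev P := (map_poly kappa P).[u].

Let evM P Q : ev (P * Q) = ev P * ev Q.
Proof. by rewrite /ev rmorphM hornerM. Qed.

Let evB P Q : ev (P - Q) = ev P - ev Q.
Proof. by rewrite /ev rmorphB hornerD hornerN. Qed.

Lemma simple_extB x y : simple_ext x -> simple_ext y -> simple_ext (x - y).
Proof.
move=> [P [Q [Q0 ->]]] [P' [Q' [Q'0 ->]]]; exists (P * Q' - P' * Q), (Q * Q').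
rewrite -!/(ev _) in Q0 Q'0 *; rewrite evB !evM mulf_neq0 //; split=> //.
by rewrite -mulNr addf_div // mulNr.
Qed.

Lemma simple_extM x y : simple_ext x -> simple_ext y -> simple_ext (x * y).
Proof.
move=> [P [Q [Q0 ->]]] [P' [Q' [Q'0 ->]]]; exists (P * P'), (Q * Q').
by rewrite -!/(ev _) in Q0 Q'0 *; rewrite !evM mulf_neq0 // mulf_div.
Qed.

Lemma simple_ext_const k : simple_ext (kappa k).
Proof.
exists k%:P, 1; rewrite rmorph1 map_polyC !hornerC oner_neq0 divr1.
by split.
Qed.

Lemma simple_extV x : simple_ext x -> simple_ext x^-1.
Proof.
move=> [P [Q [Q0 ->]]]; have [->|P0] := eqVneq (map_poly kappa P).[u] 0.
  by rewrite mul0r invr0 -(rmorph0 kappa); apply: simple_ext_const.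
by exists Q, P; rewrite invf_div.
Qed.

Lemma simple_ext_id : simple_ext u.
Proof. by exists 'X, 1; rewrite rmorph1 map_polyX hornerX hornerC oner_neq0 divr1. Qed.

End SimpleExtension.

Lemma msize_cofactor (R : idomainType) (n : nat) (p q r : {mpoly R[n]}) :
  r = p * q -> r != 0 -> (msize r <= msize q)%N -> (msize p <= 1)%N.
Proof.
move=> rE r0; have [p0 q0] : p != 0 /\ q != 0.
  by split; apply: contraNneq r0 => e0; rewrite rE e0 ?mulr0 ?mul0r.
rewrite rE msizeM // (mpolySpred _ p0) addSn succnK -{2}[msize q]add0n leq_add2r.
by rewrite leqn0 => /eqP ->.
Qed.

Lemma swap_mpoly_const (R : idomainType) (n : nat) (Q : {mpoly {mpoly R[n]}[n]}) :
  (msize (swap_mpoly Q) <= 1)%N -> Q = map_mpoly (@mpolyC n R) (swap_mpoly Q)@_0.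
Proof.
move=> /msize1_polyC sQ; apply/mpolyP => a; apply/mpolyP => b.
rewrite -mcoeff_swap_mpoly {1}sQ; move: (swap_mpoly Q)@_0 => c.
rewrite [c%:MP@_b]mcoeffC [(map_mpoly _ c)@_a]mcoeff_map_mpoly [RHS]mcoeffC.
by case: (b == 0%MM); rewrite ?mulr1 // !mulr0 mcoeff0.
Qed.

Lemma mcoeff_map_proportional (R1 R2 R : nzRingType) (n : nat)
    (f : {rmorphism R1 -> R}) (g : {rmorphism R2 -> R}) (t : R)
    (p : {mpoly R1[n]}) (q : {mpoly R2[n]}) m :
  map_mpoly f p = t *: map_mpoly g q -> f p@_m = t * g q@_m.
Proof. by move/(congr1 (mcoeff m)); rewrite mcoeffZ !mcoeff_map_mpoly. Qed.

Lemma map_mpolyB (R S : nzRingType) (n : nat) (f : {rmorphism R -> S})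
    (p q : {mpoly R[n]}) : map_mpoly f (p - q) = map_mpoly f p - map_mpoly f q.
Proof. exact: rmorphB. Qed.

Lemma map_mpolyM (R S : comNzRingType) (n : nat) (f : {rmorphism R -> S})
    (p q : {mpoly R[n]}) : map_mpoly f (p * q) = map_mpoly f p * map_mpoly f q.
Proof. exact: rmorphM. Qed.

Lemma map_mpolyCM (R S : comNzRingType) (n : nat) (f : {rmorphism R -> S}) c
    (p : {mpoly R[n]}) : map_mpoly f (c%:MP * p) = f c *: map_mpoly f p.
Proof. by rewrite rmorphM /= map_mpolyC mul_mpolyC. Qed.

Lemma map_mpoly_ext_comp (R1 R2 R3 : nzRingType) (n : nat)
    (f : {rmorphism R2 -> R3}) (g : {rmorphism R1 -> R2})
    (h : {rmorphism R1 -> R3}) (p : {mpoly R1[n]}) :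
  (forall x, f (g x) = h x) -> map_mpoly f (map_mpoly g p) = map_mpoly h p.
Proof. by move=> fg; apply/mpolyP => m; rewrite !mcoeff_map_mpoly /= fg. Qed.

(** Gauss's lemma in several variables: once the denominators of [Z] are cleared, [S] divides a
    constant multiple of [X], and the constant cancels because [S] has content 1. *)
Lemma primitive_dvdr_frac (R : idomainType) (F : fieldType)
    (phi : {rmorphism R -> F}) (n : nat) (S X : {mpoly R[n]}) (Z : {mpoly F[n]}) :
  gcd_domain R -> injective phi ->
  (forall x, exists a b, b != 0 /\ x = phi a / phi b) ->
  (forall d : R, dvdr d%:MP S -> d \is a GRing.unit) ->
  map_mpoly phi X = Z * map_mpoly phi S -> dvdr S X.
Proof.
move=> gcdR inj frac S1 XE.
have [c [Z0 [c0 Z0E]]] := clear_denominators Z inj frac.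
apply: (primitive_euclid gcdR c0) => //; exists Z0.
have injm : injective (map_mpoly phi : {mpoly R[n]} -> _).
  by move=> x y xy; apply/mpolyP => m; apply: inj; rewrite -!mcoeff_map_mpoly xy.
by apply: injm; rewrite map_mpolyCM map_mpolyM XE Z0E scalerAl.
Qed.

(* By additivity of the degree in the coefficient variables, the cofactor does *)
(* not involve them.                                                           *)
Lemma swap_cofactor (R : idomainType) (n : nat) (S X : {mpoly {mpoly R[n]}[n]}) :
  dvdr S X -> X != 0 -> (msize (swap_mpoly X) <= msize (swap_mpoly S))%N ->
  exists N : {mpoly R[n]}, N != 0 /\ X = map_mpoly (@mpolyC n R) N * S.
Proof.
move=> [N XE] X0 le.
have sN : (msize (swap_mpoly N) <= 1)%N.
  apply: msize_cofactor le; rewrite ?swap_mpoly_eq0 //.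
  by rewrite XE rmorphM.
have NE := swap_mpoly_const sN; exists (swap_mpoly N)@_0; rewrite -NE; split=> //.
apply: contraNneq X0 => N0; rewrite XE NE N0 -/(map_mpoly _ _) rmorph0 mul0r //.
Qed.

Section Luroth.

(* Keeps failed unifications from unfolding nested polynomial rings. *)
Local Opaque map_mpoly mmap.

Variables (K : fieldType) (n : nat) (E : fieldType).
Variable phi : {rmorphism {mpoly K[n]} -> E}.
Hypothesis phi_inj : injective phi.
Hypothesis phi_frac : forall x, exists a b, b != 0 /\ x = phi a / phi b.
Local Notation kappa := (phi \o @mpolyC n K).
Local Notation phi0 := (phi_eq0 phi_inj).
Local Notation mapC := (map_mpoly (@mpolyC n K)).

(** With x in the coefficients and y as outer variables, this is q(x) p(y) - p(x) q(y). *)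
Definition cross (p q : {mpoly K[n]}) : {mpoly {mpoly K[n]}[n]} :=
  q%:MP * mapC p - p%:MP * mapC q.

Lemma mcoeff_cross p q al be :
  ((cross p q)@_al)@_be = q@_be * p@_al - p@_be * q@_al.
Proof.
have h (x y : {mpoly K[n]}) : ((x%:MP * mapC y)@_al)@_be = x@_be * y@_al.
  by rewrite mcoeffCM mcoeff_map_mpoly [_ * _]mulrC mcoeffCM mulrC.
by rewrite -!h -mcoeffB -mcoeffB.
Qed.

Lemma map_cross p q : map_mpoly phi (cross p q) =
  phi q *: map_mpoly kappa p - phi p *: map_mpoly kappa q.
Proof.
have kE r : map_mpoly phi (mapC r) = map_mpoly kappa r by exact: map_mpoly_ext_comp.
by rewrite /cross map_mpolyB -!kE; congr (_ - _); apply: map_mpolyCM.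
Qed.

Lemma cross_neq0 p q : q != 0 -> (forall k, phi p / phi q <> kappa k) ->
  cross p q != 0.
Proof.
move=> q0 pqK; apply/eqP => c0.
pose al := mlead q; have qal : q@_al != 0 by rewrite mleadc_eq0.
apply: (pqK (p@_al / q@_al)).
apply: (canLR (mulfK _)); first by rewrite phi0.
rewrite /= -rmorphM; congr (phi _); apply/mpolyP => be.
rewrite mcoeffCM; apply: (mulIf qal); rewrite mulrAC divfK // [RHS]mulrC.
by have /eqP := mcoeff_cross p q al be; rewrite c0 !mcoeff0 eq_sym subr_eq0 => /eqP.
Qed.

(** The degree of [cross p q] in x is at most max(deg p, deg q), and [S] reaches this degree in x
    because [p] and [q] are among its coefficients. *)
Lemma msize_swap_cross (p q : {mpoly K[n]}) (S : {mpoly {mpoly K[n]}[n]}) :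
  (exists al, S@_al = p) -> (exists al, S@_al = q) ->
  (msize (swap_mpoly (cross p q)) <= msize (swap_mpoly S))%N.
Proof.
move=> [al pE] [al' qE]; apply: (@leq_trans (maxn (msize p) (msize q))).
  apply/msize_leP => be; rewrite geq_max => /andP[pbe qbe].
  apply/mpolyP => ga; rewrite mcoeff_swap_mpoly mcoeff_cross mcoeff0.
  rewrite (memN_msupp_eq0 (msize_mdeg_ge pbe)) (memN_msupp_eq0 (msize_mdeg_ge qbe)).
  by rewrite !mul0r subr0.
rewrite geq_max; apply/andP; split; apply/msize_leP => be sbe.
  by rewrite -pE -mcoeff_swap_mpoly (memN_msupp_eq0 (msize_mdeg_ge sbe)) mcoeff0.
by rewrite -qE -mcoeff_swap_mpoly (memN_msupp_eq0 (msize_mdeg_ge sbe)) mcoeff0.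
Qed.

Variables (L : fieldType) (iota : {rmorphism K -> L}) (j : {rmorphism L -> E}).
Hypothesis j_iota : forall c, j (iota c) = kappa c.
Local Notation KL := (map_mpoly iota).

Variable v : L.
Hypothesis v_transc : forall k, j v <> kappa k.
Hypothesis v_alg : forall w : L, exists P : {poly {poly K}},
  P != 0 /\ (map_poly (fun c : {poly K} => (map_poly kappa c).[j v]) P).[j w] = 0.

Theorem luroth : exists u : E, forall w : L, simple_ext kappa u (j w).
Proof.
have [a [b [b0 vE ab]]] := (reduced_fraction phi_inj phi_frac) (j v).
pose D := KL a - v%:MP * KL b.
have psiD : generic_eval phi j D = 0.
  rewrite rmorphB rmorphM /= !(generic_eval_map j_iota) generic_evalC vE.
  by rewrite divfK ?subrr // phi0.
(* If a(y) = v b(y), a nonzero coefficient of [b] exhibits [v] as a ratio of constants. *)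
have D0 : D != 0.
  apply/eqP => D0; pose al := mlead b.
  have bal : b@_al != 0 by rewrite mleadc_eq0.
  apply: (v_transc (k := a@_al / b@_al)); rewrite -j_iota; congr (j _).
  rewrite fmorph_div /=; apply/esym/(canLR (mulfK _)); first by rewrite fmorph_eq0.
  have /eqP := congr1 (mcoeff al) D0.
  by rewrite mcoeffB mcoeffCM !mcoeff_map_mpoly mcoeff0 subr_eq0 => /eqP.
have [m [m0 psim mD m_prime]] := prime_factor (psi := generic_eval phi j) D0 psiD.
have key0 := dvdr_relation phi_inj phi_frac j_iota v_transc v_alg b0 vE ab psim mD
  m_prime.
have j_map (r : {mpoly K[n]}) : map_mpoly j (KL r) = map_mpoly kappa r.
  exact: map_mpoly_ext_comp.
have key w e f : f != 0 -> j w = phi e / phi f -> exists Z,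
    map_mpoly kappa e - j w *: map_mpoly kappa f = map_mpoly j Z * map_mpoly j m.
  move=> f0 wE; have [Z ZE] := key0 w e f f0 wE; exists Z.
  by rewrite -!j_map -map_mpolyCM -map_mpolyB -map_mpolyM ZE.
have [c [S0 [c0 S0E]]] := clear_denominators (map_mpoly j m) phi_inj phi_frac.
have gcdK := @gcd_domain_mpolyK K n.
have S00 : S0 != 0.
  apply: contraNneq m0 => S00; apply/eqP/mpolyP => al; apply: (fmorph_inj j).
  have := congr1 (mcoeff al) S0E; rewrite S00 rmorph0 mcoeffZ mcoeff_map_mpoly !mcoeff0.
  move/esym/eqP; rewrite mulf_eq0 phi0 (negPf c0) /= => /eqP ->.
  by rewrite rmorph0.
have [d [S [d0 SE S1]]] := primitive_mpoly gcdK S00.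
have [t [t0 tE]] : exists t : E, t != 0 /\ map_mpoly phi S = t *: map_mpoly j m.
  exists (phi c / phi d); split; first by rewrite mulf_neq0 ?invr_eq0 ?phi0.
  rewrite mulrC -scalerA -[phi c *: _]S0E SE map_mpolyZ scalerA mulVf ?scale1r //.
  by rewrite phi0.
pose al0 := mlead m; pose q := S@_al0.
have SjE al : phi S@_al = t * j m@_al.
  exact: mcoeff_map_proportional tE.
have mal0 : m@_al0 != 0 by rewrite mleadc_eq0.
have q0 : q != 0.
  by rewrite -phi0 /q SjE mulf_neq0 // fmorph_eq0.
(* Otherwise a nonzero multiple of [m] would have all its coefficients in K and vanish at y = x,
   which is impossible. *)
have [al uK] : exists al, forall k, m@_al / m@_al0 <> iota k.
  have [//|no] := boolp.EM (exists al, forall k, m@_al / m@_al0 <> iota k).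
  have [m' m'E] : exists m', (m@_al0)^-1 *: m = KL m'.
    apply: mpoly_image => al; rewrite mcoeffZ mulrC.
    have [//|no'] := boolp.EM (exists k, m@_al / m@_al0 = iota k).
    by case: no; exists al => k kE; apply: no'; exists k.
  have /eqP : generic_eval phi j ((m@_al0)^-1 *: m) = 0.
    by rewrite -mul_mpolyC rmorphM /= psim mulr0.
  rewrite m'E (generic_eval_map j_iota) phi0 => /eqP m'0.
  have := m'E; rewrite m'0 rmorph0 => /eqP.
  by rewrite mscalerI invr_eq0 (negPf mal0) (negPf m0).
pose p := S@_al; pose u := m@_al / m@_al0.
have uE : j u = phi p / phi q.
  by rewrite fmorph_div !SjE -mulf_div divff // mul1r.
have pqK k : phi p / phi q <> kappa k.
  by rewrite -uE -j_iota => /fmorph_inj; apply: uK.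
have cr0 := cross_neq0 q0 pqK.
have crE : map_mpoly phi (cross p q) =
    phi q *: (map_mpoly kappa p - j u *: map_mpoly kappa q).
  rewrite map_cross scalerBr scalerA.
  by rewrite uE mulrC divfK // phi0.
have crN : dvdr S (cross p q).
  have [Z ZE] := key u p q q0 uE.
  apply: (primitive_dvdr_frac (Z := phi q *: (t^-1 *: map_mpoly j Z)) gcdK phi_inj) => //.
  by rewrite crE ZE tE -!scalerAl -scalerAr [t^-1 *: _]scalerA mulVf // scale1r.
(* [cross p q] is a multiple of [S] of no larger degree in x, so the cofactor involves y only. *)
have [N' [N'0 NE]] : exists N' : {mpoly K[n]}, N' != 0 /\ cross p q = mapC N' * S.
  by apply: swap_cofactor crN cr0 _; apply: msize_swap_cross; [exists al|exists al0].
exists (j u) => w; have [e [f [f0 wE _]]] := (reduced_fraction phi_inj phi_frac) (j w).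
(* If j w is not in K(j u), linear disjointness makes M = p(y) - u q(y) divide N'(y) f(y). At y = x,
   where M vanishes, this gives N' f = 0, a contradiction. *)
have [//|nw] := boolp.EM (simple_ext kappa (j u) (j w)).
pose M := map_mpoly kappa p - j u *: map_mpoly kappa q.
have Mcr : phi q *: M = map_mpoly kappa N' * (t *: map_mpoly j m).
  rewrite -crE NE map_mpolyM tE; congr (_ * _); exact: map_mpoly_ext_comp.
have [Z ZE] := key w e f f0 wE.
have dvdM : map_mpoly kappa (N' * e) - j w *: map_mpoly kappa (N' * f) =
    ((t^-1 * phi q) *: map_mpoly j Z) * M.
  rewrite -scalerAl -scalerA scalerAr Mcr -!scalerAr scalerA mulVf // scale1r.
  by rewrite mulrCA -ZE mulrBr -scalerAr !rmorphM.
have M0 : M != 0.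
  apply: contraNneq cr0 => M0; have := crE; rewrite -/M M0 scaler0 => cr0.
  apply/eqP/mpolyP => be; apply: phi_inj.
  by rewrite -mcoeff_map_mpoly cr0 !mcoeff0 rmorph0.
have FK (r : {mpoly K[n]}) be : simple_ext kappa (j u) (map_mpoly kappa r)@_be.
  by rewrite mcoeff_map_mpoly; apply: simple_ext_const.
have FM be : simple_ext kappa (j u) M@_be.
  rewrite mcoeffB mcoeffZ; apply: simple_extB => //.
  by apply: simple_extM => //; apply: simple_ext_id.
have [Y YE] : dvdr M (map_mpoly kappa (N' * f)).
  apply: (linear_disjoint_dvdr (F := simple_ext kappa (j u))) M0 FM _ _ nw dvdM => //.
  - by move=> x y; apply: simple_extB.
  - by move=> x y; apply: simple_extM.
  - by move=> x y Fx Fy; apply: simple_extM => //; apply: simple_extV.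
pose ev : {rmorphism {mpoly E[n]} -> E} := mmap idfun (fun i => phi 'X_i).
have evK r : ev (map_mpoly kappa r) = phi r.
  pose g : {rmorphism _ -> _} := ev \o map_mpoly kappa.
  have : g =1 phi; last exact.
  apply: mpoly_rmorph_ext => [x|i]; rewrite /g /=.
    by rewrite map_mpolyC mmapC.
  by rewrite map_mpolyX mmapX mmap1U.
have /eqP : ev (map_mpoly kappa (N' * f)) = 0.
  rewrite YE rmorphM rmorphB -mul_mpolyC rmorphM !evK /= mmapC /= uE.
  by rewrite divfK ?subrr ?mulr0 // phi0.
by rewrite evK phi0 mulf_eq0 (negPf N'0) (negPf f0).
Qed.

End Luroth.

(** * Generated subfields and the bound on the transcendence degree *)

Section AdjoinField.
Variables (K E : fieldType) (kappa : {rmorphism K -> E}) (n : nat) (z : 'I_n -> E).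

Definition adjoin_pred : {pred E} := fun w => boolp.asbool (adjoin kappa z w).

Lemma adjoin_predP w : reflect (adjoin kappa z w) (w \in adjoin_pred).
Proof. exact: boolp.asboolP. Qed.

Lemma adjoin_divring_closed : divring_closed adjoin_pred.
Proof.
split=> [|x y|x y].
- by apply/adjoin_predP; exists 1, 1; rewrite rmorph1 oner_neq0 divr1.
- move=> /adjoin_predP[P [Q [Q0 ->]]] /adjoin_predP[P' [Q' [Q'0 ->]]].
  apply/adjoin_predP; exists (P * Q' - P' * Q), (Q * Q').
  rewrite rmorphB !rmorphM mulf_neq0 //; split=> //.
  by rewrite -[- (_ / _)]mulNr addf_div // mulNr.
move=> /adjoin_predP[P [Q [Q0 ->]]] /adjoin_predP[P' [Q' [Q'0 ->]]].
have [P'0|P'0] := eqVneq (mmap kappa z P') 0.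
  apply/adjoin_predP; exists 0, 1; rewrite rmorph0 rmorph1 oner_neq0.
  by split=> //; rewrite P'0 mul0r invr0 mulr0 divr1.
apply/adjoin_predP; exists (P * Q'), (Q * P').
by rewrite !rmorphM mulf_neq0 // invf_div mulf_div.
Qed.

HB.instance Definition _ :=
  GRing.isDivringClosed.Build E adjoin_pred adjoin_divring_closed.

Let mmap_one : mmap kappa z 1 = 1 := rmorph1 (mmap kappa z).

Lemma adjoin_const c : kappa c \in adjoin_pred.
Proof.
apply/adjoin_predP; exists c%:MP, 1.
by rewrite mmap_one oner_neq0 divr1 mmapC.
Qed.

Lemma adjoin_gen i : z i \in adjoin_pred.
Proof.
apply/adjoin_predP; exists 'X_i, 1.
by rewrite mmap_one oner_neq0 divr1 mmapX mmap1U.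
Qed.

(** K(z) as a field in its own right, the form in which [luroth] takes its [L]. *)
Record adjoin_field := AdjoinField {
  adjoin_val :> E;
  adjoin_valP : adjoin_val \in adjoin_pred
}.

HB.instance Definition _ := [isSub for adjoin_val].
HB.instance Definition _ := [Choice of adjoin_field by <:].
HB.instance Definition _ := [SubChoice_isSubIntegralDomain of adjoin_field by <:].
HB.instance Definition _ := [SubIntegralDomain_isSubField of adjoin_field by <:].

Definition adjoin_incl : {rmorphism adjoin_field -> E} := val.

Definition adjoin_scalar (c : K) : adjoin_field := AdjoinField (adjoin_const c).

Lemma adjoin_scalar_zmod : zmod_morphism adjoin_scalar.
Proof. by move=> x y; apply: val_inj; rewrite /= rmorphB. Qed.

Lemma adjoin_scalar_monoid : monoid_morphism adjoin_scalar.
Proof.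
by split=> [|x y]; apply: val_inj; rewrite /= ?rmorph1 ?rmorphM.
Qed.

HB.instance Definition _ :=
  GRing.isZmodMorphism.Build K adjoin_field adjoin_scalar adjoin_scalar_zmod.
HB.instance Definition _ :=
  GRing.isMonoidMorphism.Build K adjoin_field adjoin_scalar adjoin_scalar_monoid.

End AdjoinField.

Lemma adjoin_trans (K E F : fieldType) (kappa : {rmorphism K -> E})
    (kappa' : {rmorphism K -> F}) (f : {rmorphism E -> F}) (m n : nat)
    (z : 'I_m -> E) (y : 'I_n -> F) w :
  (forall c, f (kappa c) = kappa' c) ->
  (forall i, f (z i) \in adjoin_pred kappa' y) ->
  w \in adjoin_pred kappa z -> f w \in adjoin_pred kappa' y.
Proof.
move=> fk fz /adjoin_predP[P [Q [_ ->]]].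
have fP (R : {mpoly K[m]}) : f (mmap kappa z R) \in adjoin_pred kappa' y.
  rewrite rmorph_sum rpred_sum // => a _; rewrite rmorphM fk.
  rewrite rpredM ?adjoin_const // rmorph_prod rpred_prod // => i _.
  by rewrite rmorphXn rpredX.
by rewrite fmorph_div rpred_div.
Qed.

(* The family is [t h, v, w] with [t] an indeterminate over [E]: compare the   *)
(* coefficients of the powers of [t].                                          *)
Lemma alg_indep_scale (K E F : fieldType) (kappa : {rmorphism K -> E})
    (f : {rmorphism {poly E} -> F}) (iota : {rmorphism K -> F}) (h v w : E)
    (z : 'I_3 -> F) :
  injective f -> (forall c, iota c = f (kappa c)%:P) ->
  z 0 = f ('X * h%:P) -> z 1 = f v%:P -> z 2 = f w%:P -> h != 0 ->
  (forall P : {poly {poly K}},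
    (map_poly (fun c : {poly K} => (map_poly kappa c).[v]) P).[w] = 0 -> P = 0) ->
  alg_indep iota z.
Proof.
move=> f_inj iotaE z0 z1 z2 h0 indep P P0.
pose ev1 : {rmorphism {poly K} -> E} := horner_eval v \o map_poly kappa.
pose ev : {rmorphism {poly {poly K}} -> E} := horner_eval w \o map_poly ev1.
(* [B k] gathers the terms of [P] of degree [k] in the first variable. The coefficient of t^k in the
   relation is [h ^+ k] times the value of [B k] at (v, w). *)
pose B k : {poly {poly K}} :=
  \sum_(a <- msupp P | a 0 == k) (P@_a *: 'X^(a 1))%:P * 'X^(a 2).
have evC c : ev c%:P = ev1 c.
  by rewrite -[LHS]/((map_poly ev1 c%:P).[w]) map_polyC hornerC.
have evX : ev 'X = w by rewrite -[LHS]/((map_poly ev1 'X).[w]) map_polyX hornerX.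
have evT c i k : ev ((c *: 'X^i)%:P * 'X^k) = kappa c * v ^+ i * w ^+ k.
  rewrite rmorphM rmorphXn evC evX /ev1 /= /horner_eval map_polyZ map_polyXn.
  by rewrite hornerZ hornerXn.
have mE a : f ((kappa P@_a)%:P * ('X * h%:P) ^+ a 0 * v%:P ^+ a 1 * w%:P ^+ a 2) =
    iota P@_a * mmap1 z a.
  rewrite /mmap1 !big_ord_recl big_ord0 mulr1 iotaE.
  have -> : lift ord0 ord0 = 1 :> 'I_3 by apply: val_inj.
  have -> : lift ord0 (lift ord0 ord0) = 2 :> 'I_3 by apply: val_inj.
  by rewrite z0 z1 z2 -!(rmorphXn f) -!(rmorphM f) !mulrA.
have sum0 : \sum_(a <- msupp P)
    (kappa P@_a)%:P * ('X * h%:P) ^+ a 0 * v%:P ^+ a 1 * w%:P ^+ a 2 = 0.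
  apply: f_inj; rewrite rmorph_sum rmorph0.
  transitivity (mmap iota z P); last exact: P0.
  by apply: eq_bigr => a _; apply: mE.
have B0 k : B k = 0.
  apply: indep; rewrite -[LHS]/(ev (B k)).
  apply: (mulfI (expf_neq0 k h0)); rewrite mulr0 /B rmorph_sum mulr_sumr.
  have := congr1 (coefp k) sum0; rewrite raddf_sum raddf0 => sk; apply: etrans sk.
  rewrite [LHS]big_mkcond; apply: eq_bigr => a _; rewrite evT /coefp.
  have -> : (kappa P@_a)%:P * ('X * h%:P) ^+ a 0 * v%:P ^+ a 1 * w%:P ^+ a 2 =
      (h ^+ a 0 * (kappa P@_a * v ^+ a 1 * w ^+ a 2)) *: 'X^(a 0).
    by rewrite -mul_polyC !polyCM !polyC_exp exprMn; ring.
  rewrite /= coefZ coefXn eq_sym; case: eqVneq => [->|_]; first by rewrite mulr1.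
  by rewrite mulr0.
apply/mpolyP => a; rewrite mcoeff0.
have [aP|/memN_msupp_eq0 //] := boolP (a \in msupp P).
have := congr1 (fun Q : {poly {poly K}} => Q`_(a 2)`_(a 1)) (B0 (a 0)).
rewrite /= !coef0 /B !coef_sum [LHS]big_mkcond (bigD1_seq a) //= eqxx.
rewrite big1_seq ?addr0 => [|b].
  by rewrite coefCM coefXn eqxx mulr1 coefZ coefXn eqxx mulr1.
move=> /andP[ba _]; case: eqP => // ba0; rewrite coefCM coefXn.
case: eqVneq => [b2|_]; last by rewrite mulr0 coef0.
rewrite mulr1 coefZ coefXn; case: eqVneq => [b1|_]; last by rewrite mulr0.
case/eqP: ba; apply/mnmP => i; case: i => -[|[|[|//]]] lt.
- by rewrite (_ : Ordinal lt = 0) //; apply: val_inj.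
- by rewrite (_ : Ordinal lt = 1) //; apply: val_inj.
- by rewrite (_ : Ordinal lt = 2) //; apply: val_inj.
Qed.

Lemma luroth_family (K E : fieldType) (n m : nat)
    (phi : {rmorphism {mpoly K[n]} -> E}) (z : 'I_m -> E) :
  let kappa := phi \o @mpolyC n K in
  injective phi -> (forall x, exists a b, b != 0 /\ x = phi a / phi b) ->
  (forall v w, v \in adjoin_pred kappa z -> w \in adjoin_pred kappa z ->
    exists P : {poly {poly K}}, P != 0 /\
      (map_poly (fun c : {poly K} => (map_poly kappa c).[v]) P).[w] = 0) ->
  exists u, forall i, simple_ext kappa u (z i).
Proof.
move=> kappa inj frac dep.
have [[i zi]|const] := boolp.EM (exists i, forall c, z i <> kappa c); last first.
  (* All the z_i are constants, so any u will do. *)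
  exists 0 => i; have [[c ->]|nc] := boolp.EM (exists c, z i = kappa c).
    exact: simple_ext_const.
  by case: const; exists i => c zc; apply: nc; exists c.
pose j := adjoin_incl kappa z; pose v := AdjoinField (adjoin_gen kappa z i).
have jE c : j (adjoin_scalar kappa z c) = kappa c by [].
have vK c : j v <> kappa c by apply: zi.
have [|u uP] := luroth inj frac jE vK.
  by move=> w; apply: dep; [apply: adjoin_gen|apply: adjoin_valP].
by exists u => k; apply: (uP (AdjoinField (adjoin_gen kappa z k))).
Qed.

(** Common denominator: [f i] is the numerator of z_i times the denominators of the others, and [g]
    is the inverse of the product of all denominators. *)
Lemma simple_ext_family (K E : fieldType) (n : nat) (kappa : {rmorphism K -> E})
    (u : E) (z : 'I_n -> E) : (forall i, simple_ext kappa u (z i)) ->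
  exists (f : 'I_n -> {poly K}) (g : E),
    forall i, z i = g * (map_poly kappa (f i)).[u].
Proof.
move=> /boolp.choice[P /boolp.choice[Q PQ]].
pose ev c := (map_poly kappa c).[u].
have evM c d : ev (c * d) = ev c * ev d by rewrite /ev rmorphM hornerM.
have evP (p : pred 'I_n) : ev (\prod_(j | p j) Q j) = \prod_(j | p j) ev (Q j).
  by rewrite /ev rmorph_prod horner_prod.
exists (fun i => P i * \prod_(j | j != i) Q j), (\prod_j ev (Q j))^-1 => i.
have [Q0 ->] := PQ i; rewrite -!/(ev _) evM evP (bigD1 i) //=.
have R0 : \prod_(j | j != i) ev (Q j) != 0.
  by apply/prodf_neq0 => j _; have [] := PQ j.
by rewrite invfM mulrACA mulVf // mulr1 mulrC.
Qed.

Section RatfunFacts.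
Variables (K : fieldType) (n : nat).

Lemma pfrac_inj : injective (pfrac K n).
Proof. by move=> p q /eqP; rewrite tofrac_eq => /eqP. Qed.

Lemma ratfun_frac (x : ratfun K n) :
  exists a b, b != 0 /\ x = pfrac K n a / pfrac K n b.
Proof. exact: fractionP. Qed.

Lemma tfrac_polyC_div (x y : ratfun K n) : y != 0 ->
  tfrac K n ('X * x%:P) / tfrac K n ('X * y%:P) = tfrac K n (x / y)%:P.
Proof.
move=> y0; have Xy : tfrac K n ('X * y%:P) != 0.
  by rewrite tofrac_eq0 mulf_neq0 ?polyX_eq0 ?polyC_eq0.
apply: (canLR (mulfK Xy)); rewrite -rmorphM mulrCA -polyCM divfK //.
Qed.

(** If [v] and [w] were independent, then t H_i0, v, w would be three independent elements of K(tH),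
    which contains the ratios since H_i / H_i0 = t H_i / (t H_i0). *)
Lemma trdeg_ratio_dependent (H : 'cV[ratfun K n]_n) (i0 : 'I_n) v w :
  trdeg_le (cfrac_t K n) (adjoin (cfrac_t K n) (t_scale H)) 2 ->
  H i0 0 != 0 ->
  v \in adjoin_pred (cfrac K n) (fun i => H i 0 / H i0 0) ->
  w \in adjoin_pred (cfrac K n) (fun i => H i 0 / H i0 0) ->
  exists P : {poly {poly K}}, P != 0 /\
    (map_poly (fun c : {poly K} => (map_poly (cfrac K n) c).[v]) P).[w] = 0.
Proof.
move=> tr h0 vA wA.
have [//|no] := boolp.EM (exists P : {poly {poly K}}, P != 0 /\
    (map_poly (fun c : {poly K} => (map_poly (cfrac K n) c).[v]) P).[w] = 0).
pose z (k : 'I_3) := tnth [tuple t_scale H i0; tfrac K n v%:P; tfrac K n w%:P] k.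
have zA x : x \in adjoin_pred (cfrac K n) (fun i => H i 0 / H i0 0) ->
    tfrac K n x%:P \in adjoin_pred (cfrac_t K n) (t_scale H).
  pose f : {rmorphism ratfun K n -> ratfun_t K n} := tfrac K n \o polyC.
  rewrite -[tfrac K n x%:P]/(f x); apply: adjoin_trans => // i.
  by rewrite /f /= -tfrac_polyC_div // rpred_div // adjoin_gen.
have : (3 <= 2)%N; last by [].
apply: (tr 3 z).
  move=> k; apply/adjoin_predP; case: k => -[|[|[|//]]] lt.
  - exact: adjoin_gen.
  - exact: zA.
  - exact: zA.
apply: (alg_indep_scale (kappa := cfrac K n) (f := tfrac K n)
    (h := H i0 0) (v := v) (w := w)) => //.
  by move=> p q /eqP; rewrite tofrac_eq => /eqP.
move=> P Pvw; apply/eqP/negP => /negP P0; apply: no; by exists P.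
Qed.

Lemma luroth_tuple (H : 'cV[ratfun K n]_n) : H != 0 ->
  trdeg_le (cfrac_t K n) (adjoin (cfrac_t K n) (t_scale H)) 2 ->
  exists (u g : ratfun K n) (f : 'cV[{poly K}]_n), H = g *: eval_frac f u.
Proof.
move=> H0 tr; have [i0 h0] : exists i, H i 0 != 0.
  by move/cV0Pn: H0.
have [|u uP] := luroth_family pfrac_inj ratfun_frac (z := fun i => H i 0 / H i0 0).
  by move=> v w; apply: trdeg_ratio_dependent.
have [f [g fg]] := simple_ext_family uP.
exists u, (H i0 0 * g), (\col_i f i); apply/colP => i; rewrite !mxE.
by rewrite -mulrA -fg mulrC divfK.
Qed.

End RatfunFacts.

(** * Derivations of rational functions *)

Lemma quotient_rule_add (F : fieldType) (a a' b b' c c' d d' : F) :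
  b != 0 -> d != 0 ->
  ((a' * d + a * d' + (c' * b + c * b')) * (b * d) -
     (a * d + c * b) * (b' * d + b * d')) / (b * d) ^+ 2 =
  (a' * b - a * b') / b ^+ 2 + (c' * d - c * d') / d ^+ 2.
Proof. by move=> b0 d0; field; rewrite b0 d0. Qed.

Lemma quotient_rule_mul (F : fieldType) (a a' b b' c c' d d' : F) :
  b != 0 -> d != 0 ->
  ((a' * c + a * c') * (b * d) - (a * c) * (b' * d + b * d')) / (b * d) ^+ 2 =
  (a' * b - a * b') / b ^+ 2 * (c / d) + (a / b) * ((c' * d - c * d') / d ^+ 2).
Proof. by move=> b0 d0; field; rewrite b0 d0. Qed.

Section Derivations.
Variables (K E : fieldType) (n : nat) (phi : {rmorphism {mpoly K[n]} -> E}).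
Hypothesis phi_inj : injective phi.
Hypothesis phi_frac : forall x, exists a b, b != 0 /\ x = phi a / phi b.
Local Notation kappa := (phi \o @mpolyC n K).
Local Notation phi0 := (phi_eq0 phi_inj).
Implicit Types (p q : {mpoly K[n]}) (x y : E).

Variable der : 'I_n -> E -> E.
Hypothesis derE : forall j p q, q != 0 -> der j (phi p / phi q) =
  (phi p^`M(j) * phi q - phi p * phi q^`M(j)) / phi q ^+ 2.

Lemma der_phi j p : der j (phi p) = phi p^`M(j).
Proof.
have := derE j p (oner_neq0 _); rewrite rmorph1 !divr1 expr1n divr1 mulr1.
by move=> ->; rewrite -(mpolyC1 n) mderivC rmorph0 mulr0 subr0.
Qed.

Lemma derD j x y : der j (x + y) = der j x + der j y.
Proof.
have [a [b [b0 ->]]] := phi_frac x; have [c [d [d0 ->]]] := phi_frac y.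
have [fb0 fd0] : phi b != 0 /\ phi d != 0 by rewrite !phi0.
have -> : phi a / phi b + phi c / phi d = phi (a * d + c * b) / phi (b * d).
  by rewrite addf_div // rmorphD !rmorphM.
rewrite !derE ?mulf_neq0 // mderivD !mderivM !rmorphD !rmorphM.
exact: quotient_rule_add.
Qed.

Lemma derM j x y : der j (x * y) = der j x * y + x * der j y.
Proof.
have [a [b [b0 ->]]] := phi_frac x; have [c [d [d0 ->]]] := phi_frac y.
have [fb0 fd0] : phi b != 0 /\ phi d != 0 by rewrite !phi0.
have -> : phi a / phi b * (phi c / phi d) = phi (a * c) / phi (b * d).
  by rewrite mulf_div !rmorphM.
rewrite !derE ?mulf_neq0 // !mderivM !rmorphD !rmorphM.
exact: quotient_rule_mul.
Qed.

Lemma der_const j c : der j (kappa c) = 0.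
Proof. by rewrite der_phi mderivC rmorph0. Qed.

Lemma der_horner j (c : {poly K}) x :
  der j (map_poly kappa c).[x] = (map_poly kappa c^`()).[x] * der j x.
Proof.
elim/poly_ind: c => [|c k IHc].
  by rewrite deriv0 map_poly0 horner0 mul0r -[RHS](der_const j 0) rmorph0.
have -> : (map_poly kappa (c * 'X + k%:P)).[x] = (map_poly kappa c).[x] * x + kappa k.
  by rewrite rmorphD rmorphM /= map_polyX map_polyC hornerD hornerMX hornerC.
rewrite derD derM der_const IHc addr0.
rewrite derivD derivM derivX derivC addr0 mulr1 rmorphD rmorphM /= map_polyX.
by rewrite hornerD hornerMX mulrDl mulrAC.
Qed.

Definition der_along (F : 'I_n -> E) x : E := \sum_j der j x * F j.

Section Along.
Variable F : 'I_n -> E.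
Local Notation D := (der_along F).

Lemma der_alongM x y : D (x * y) = D x * y + x * D y.
Proof.
rewrite mulr_suml mulr_sumr -big_split; apply: eq_bigr => j _.
by rewrite derM mulrDl mulrAC mulrA.
Qed.

Lemma der_along_const c : D (kappa c) = 0.
Proof. by rewrite /der_along big1 // => j _; rewrite der_const mul0r. Qed.

Lemma der_alongX x k : D (x ^+ k) = k%:R * x ^+ k.-1 * D x.
Proof.
elim: k => [|k IHk]; first by rewrite expr0 -(rmorph1 kappa) der_along_const !mul0r.
rewrite exprS der_alongM IHk -[in k.+1%:R]addn1 natrD /=.
case: k {IHk} => [|k]; first by rewrite /= !expr0; ring.
by rewrite exprS /=; ring.
Qed.

Lemma der_along_horner (c : {poly K}) x :
  D (map_poly kappa c).[x] = (map_poly kappa c^`()).[x] * D x.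
Proof.
by rewrite mulr_sumr; apply: eq_bigr => j _; rewrite der_horner mulrA.
Qed.

End Along.
End Derivations.

(** * Derivatives along constant vectors *)

Section DirectionalDerivative.
Variables (K : fieldType) (n : nat).
Implicit Types (v : 'I_n -> K) (p q : {mpoly K[n]}).

Definition ddir v p : {mpoly K[n]} := \sum_j v j *: p^`M(j).

Lemma ddirM v p q : ddir v (p * q) = ddir v p * q + p * ddir v q.
Proof.
rewrite /ddir mulr_suml mulr_sumr -big_split; apply: eq_bigr => j _.
by rewrite mderivM scalerDr -scalerAl -scalerAr.
Qed.

Lemma ddirC v c : ddir v c%:MP = 0.
Proof. by rewrite /ddir big1 // => j _; rewrite mderivC scaler0. Qed.

Lemma ddir_exp v p k : ddir v p = 0 -> ddir v (p ^+ k) = 0.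
Proof.
move=> vp; elim: k => [|k IHk]; first by rewrite expr0 -mpolyC1 ddirC.
by rewrite exprS ddirM vp IHk mul0r mulr0 addr0.
Qed.

Lemma mderiv_exp j p k : (p ^+ k)^`M(j) = (p ^+ k.-1 * p^`M(j)) *+ k.
Proof.
elim: k => [|k IHk]; first by rewrite expr0 -mpolyC1 mderivC mulr0n.
rewrite exprS mderivM IHk mulrnAr /=; case: k {IHk} => [|k].
  by rewrite mulr0n addr0 expr0 mulr1 mulr1n mul1r.
by rewrite /= mulrA -exprS mulrC [RHS]mulrS.
Qed.

Lemma msize_mderiv j p : (msize p^`M(j) <= (msize p).-1)%N.
Proof.
apply/msize_leP => m pm; rewrite mcoeff_mderiv memN_msupp_eq0 ?mul0rn //.
apply: msize_mdeg_ge; rewrite mdegD mdeg1 addn1.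
by case: (msize p) pm.
Qed.

Lemma msize_ddir v p : (msize (ddir v p) <= (msize p).-1)%N.
Proof.
apply/msize_leP => m pm; rewrite raddf_sum big1 // => j _ /=.
rewrite mcoeffZ (memN_msupp_eq0 (msize_mdeg_ge _)) ?mulr0 //.
exact: leq_trans (msize_mderiv _ _) pm.
Qed.

(** Differentiation lowers the degree, so a nonzero derivative of [p] is no multiple of [p]. *)
Lemma ddir_dvdr v p : dvdr p (ddir v p) -> ddir v p = 0.
Proof.
case=> q pE; have [//|d0] := eqVneq (ddir v p) 0.
have [q0 p0] : q != 0 /\ p != 0.
  by split; apply: contraNneq d0 => e0; rewrite pE e0 ?mulr0 ?mul0r.
have := msize_ddir v p; rewrite pE msizeM // (mpolySpred _ q0) (mpolySpred _ p0).
by rewrite addSn addnS /= ltnNge leq_addl.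
Qed.

(** J p . f, whose coefficients are the derivatives of [p] along the coefficient vectors of [f]
    ([coef_gdot]). *)
Definition gdot (f : 'I_n -> {poly K}) p : {poly {mpoly K[n]}} :=
  \sum_j (p^`M(j))%:P * map_poly (@mpolyC n K) (f j).

Lemma coef_gdot f p k : (gdot f p)`_k = ddir (fun j => (f j)`_k) p.
Proof.
rewrite /gdot coef_sum; apply: eq_bigr => j _.
by rewrite coefCM coef_map /= mulrC mul_mpolyC.
Qed.

Lemma gdot_eq0P f p : gdot f p = 0 <-> forall k, ddir (fun j => (f j)`_k) p = 0.
Proof.
split=> [f0 k|f0]; first by rewrite -coef_gdot f0 coef0.
by apply/polyP => k; rewrite coef_gdot f0 coef0.
Qed.

Lemma deriv_gdot f p : (gdot f p)^`() = gdot (fun j => (f j)^`()) p.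
Proof.
rewrite /gdot raddf_sum; apply: eq_bigr => j _ /=.
by rewrite derivM derivC mul0r add0r deriv_map.
Qed.

Lemma homogenize_map (f : {poly K}) d p q :
  homogenize (map_poly (@mpolyC n K) f) d p q =
    \sum_(k < d.+1) f`_k *: (p ^+ k * q ^+ (d - k)).
Proof.
by apply: eq_bigr => k _; rewrite coef_map /= -mulrA mul_mpolyC.
Qed.

End DirectionalDerivative.

Lemma horner_map_subXM (R : idomainType) (F : fieldType) (f : {rmorphism R -> F})
    (a b : {poly R}) x :
  (map_poly f (a - 'X * b)).[x] = (map_poly f a).[x] - x * (map_poly f b).[x].
Proof. by rewrite rmorphB rmorphM /= map_polyX hornerD hornerN hornerM hornerX. Qed.

Lemma coef_subXM (R : nzRingType) (a b : {poly R}) k :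
  (a - 'X * b)`_k = a`_k - (if k == 0 then 0 else b`_k.-1).
Proof. by rewrite coefB coefXM. Qed.

Section NormalForm.
Variables (K E : fieldType) (n : nat) (phi : {rmorphism {mpoly K[n]} -> E}).
Hypothesis phi_inj : injective phi.
Hypothesis phi_frac : forall x, exists a b, b != 0 /\ x = phi a / phi b.
Local Notation kappa := (phi \o @mpolyC n K).
Local Notation phi0 := (phi_eq0 phi_inj).
Variable der : 'I_n -> E -> E.
Hypothesis derE : forall j p q, q != 0 -> der j (phi p / phi q) =
  (phi p^`M(j) * phi q - phi p * phi q^`M(j)) / phi q ^+ 2.

Local Notation ev f r := (fun j => (map_poly kappa (f j)).[r]).
Local Notation D := (der_along der).
Local Notation df f := (fun j => (f j)^`()).

Lemma gdot_root (f : 'I_n -> {poly K}) p r :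
  (map_poly phi (gdot f p)).[r] = D (ev f r) (phi p).
Proof.
rewrite rmorph_sum horner_sum; apply: eq_bigr => j _.
by rewrite rmorphM /= map_polyC hornerM hornerC -map_poly_comp (der_phi derE).
Qed.

Variables (p q : {mpoly K[n]}).
Hypotheses (pq : gcd_one [:: p; q]) (q0 : q != 0).
Local Notation r := (phi p / phi q).

Let max_gt0 : (0 < maxn (msize p) (msize q))%N.
Proof. by rewrite leq_max !lt0n !msize_poly_eq0 q0 orbT. Qed.

Let small_ddir (v : 'I_n -> K) (x : {mpoly K[n]}) :
  (msize x <= maxn (msize p) (msize q))%N ->
  (msize (ddir v x) <= (maxn (msize p) (msize q)).-1)%N.
Proof.
move=> xm; apply: leq_trans (msize_ddir _ _) _.
by rewrite -!subn1 leq_sub2r.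
Qed.

(** [gdot f x] vanishes at y = r, so q y - p divides it, while its degree in x is below max(deg p,
    deg q). *)
Lemma gdot_eq0 f (x : {mpoly K[n]}) : (msize x <= maxn (msize p) (msize q))%N ->
  D (ev f r) (phi x) = 0 -> gdot f x = 0.
Proof.
move=> xm Dx; apply: (@small_multiple_eq0 _ _ p q).
  by apply: (root_factor (@gcd_domain_mpolyK K n) phi_inj) => //; rewrite gdot_root.
by move=> k; rewrite coef_gdot -(prednK max_gt0) ltnS small_ddir.
Qed.

(** As p = r q, the hypothesis gives J p . f(r) = r (J q . f(r)): the polynomial has the root r, and
    its degree in x is too small for a nonzero multiple of q y - p. *)
Lemma gdot_ratio_eq0 f : D (ev f r) r = 0 -> gdot f p - 'X * gdot f q = 0.
Proof.
move=> Dr; apply: (@small_multiple_eq0 _ _ p q).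
  apply: (root_factor (@gcd_domain_mpolyK K n) phi_inj) => //.
  apply: etrans (horner_map_subXM phi (gdot f p) (gdot f q) r) _.
  apply: etrans (congr2 (fun a b => a - r * b) (gdot_root f p r) (gdot_root f q r)) _.
  have -> : D (ev f r) (phi p) = D (ev f r) (r * phi q).
    by rewrite divfK // phi0.
  by rewrite (der_alongM phi_inj phi_frac derE) Dr mul0r add0r subrr.
move=> k; rewrite -(prednK max_gt0) ltnS; apply/msize_leP => m mm.
have z (v : 'I_n -> K) (x : {mpoly K[n]}) :
    (msize x <= maxn (msize p) (msize q))%N -> (ddir v x)@_m = 0.
  move=> xm; apply: memN_msupp_eq0; apply: msize_mdeg_ge.
  by apply: leq_trans mm; apply: small_ddir.
have zp := z (fun j => (f j)`_k) p (leq_maxl _ _).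
have zq := z (fun j => (f j)`_k.-1) q (leq_maxr _ _).
rewrite -coef_gdot in zp; rewrite -coef_gdot in zq.
apply: etrans (congr1 (mcoeff m) (coef_subXM (gdot f p) (gdot f q) k)) _.
by rewrite mcoeffB zp sub0r; case: ifP => _; rewrite ?zq ?mcoeff0 oppr0.
Qed.

(** Differentiating the identity of [gdot_ratio_eq0] for f with respect to y and subtracting the one
    for f' leaves J q . f = 0. *)
Lemma gdot_both_eq0 f : D (ev f r) r = 0 -> D (ev (df f) r) r = 0 ->
  gdot f p = 0 /\ gdot f q = 0.
Proof.
move=> /gdot_ratio_eq0 f0 /gdot_ratio_eq0; rewrite -!deriv_gdot => f'0.
have fq0 : gdot f q = 0.
  have := congr1 deriv f0; rewrite derivB derivM derivX mul1r deriv0 opprD addrCA f'0.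
  by rewrite addr0 => /eqP; rewrite oppr_eq0 => /eqP.
by move: f0; rewrite fq0 mulr0 subr0.
Qed.

End NormalForm.

(** * Tuples of the form g f(p/q) *)

Definition gcd_one_family (R : idomainType) (n : nat) (f : 'I_n -> R) : Prop :=
  gcd_one [seq f i | i <- enum 'I_n].

Lemma gcd_family_factor (R : idomainType) (n : nat) (f : 'I_n -> R) :
  gcd_domain R -> (0 < n)%N ->
  exists d f', (forall i, f i = f' i * d) /\ gcd_one_family f'.
Proof.
move=> gcdR n0; have [|d [s' [fE s'1]]] :=
    @gcd_one_factor _ gcdR [seq f i | i <- enum 'I_n].
  by rewrite -size_eq0 size_map size_enum_ord -lt0n.
have szs : size s' = n.
  by have := congr1 size fE; rewrite [LHS]size_map size_enum_ord size_map => <-.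
exists d, (fun i => s'`_i); split=> [i|].
  have := congr1 (fun s : seq R => s`_i) fE.
  by rewrite (nth_map i) ?size_enum_ord // nth_ord_enum (nth_map 0) ?szs.
rewrite /gcd_one_family; suff -> : [seq s'`_i | i : 'I_n <- enum 'I_n] = s' by [].
apply: (@eq_from_nth _ 0) => [|k]; rewrite size_map size_enum_ord ?szs // => kn.
have i0 : 'I_n by case: (n) n0 => // m _; exact: ord0.
by rewrite (nth_map i0) ?size_enum_ord // nth_enum_ord.
Qed.

Lemma euclid_family (R : idomainType) (n : nat) (f : 'I_n -> R) a c :
  gcd_domain R -> gcd_one_family f -> (forall i, dvdr a (f i * c)) -> dvdr a c.
Proof.
by move=> gcdR f1 h; apply: (euclid_seq gcdR f1) => _ /mapP[i _ ->].
Qed.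

(** f_i divides f_j f_i' for every j, hence f_i' because the f_j are coprime; but a nonzero f_i'
    would have smaller degree. *)
Lemma proportional_deriv (K : fieldType) (n : nat) (f : 'I_n -> {poly K}) :
  gcd_one_family f -> (forall i j, f i * (f j)^`() = f j * (f i)^`()) ->
  forall i, (f i)^`() = 0.
Proof.
move=> f1 ff i; have gcdP := gcd_domain_poly (@gcd_domain_field K).
have [c fE] : dvdr (f i) (f i)^`().
  apply: (euclid_family gcdP f1) => j.
  by rewrite -ff mulrC; apply: dvdr_mull (dvdr_refl _).
have [//|d0] := eqVneq (f i)^`() 0.
have [c0 fi0] : c != 0 /\ f i != 0.
  by split; apply: contraNneq d0 => e0; rewrite fE e0 ?mulr0 ?mul0r.
have := lt_size_deriv fi0; rewrite fE size_mul // ltnNge.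
by rewrite -(prednK (_ : 0 < size c)%N) ?lt0n ?size_poly_eq0 // addSn /= leq_addl.
Qed.

Lemma zero_deriv_coef (K : fieldType) (c : nat) (f : {poly K}) k :
  has_char K c -> f^`() = 0 -> ~~ (c %| k)%N -> f`_k = 0.
Proof.
move=> charK f0; case: k => [|k ck]; first by rewrite dvdn0.
have /eqP := coef_deriv f k; rewrite f0 coef0 eq_sym -mulr_natr mulf_eq0.
by rewrite charK (negPf ck) orbF => /eqP.
Qed.

Lemma cramer2 (F : fieldType) (a b x x' y y' : F) :
  a * x + b * x' = 0 -> a * y + b * y' = 0 -> x * y' - y * x' != 0 ->
  a = 0 /\ b = 0.
Proof.
move=> ex ey w0.
have aw : a * (x * y' - y * x') = y' * (a * x + b * x') - x' * (a * y + b * y') by ring.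
have bw : b * (x * y' - y * x') = x * (a * y + b * y') - y * (a * x + b * x') by ring.
by split; apply: (mulIf w0); rewrite ?aw ?bw ex ey !mulr0 subrr mul0r.
Qed.

Section Classification.
Variables (K E : fieldType) (n : nat) (phi : {rmorphism {mpoly K[n]} -> E}).
Hypothesis phi_inj : injective phi.
Hypothesis phi_frac : forall x, exists a b, b != 0 /\ x = phi a / phi b.
Local Notation kappa := (phi \o @mpolyC n K).
Local Notation phi0 := (phi_eq0 phi_inj).
Variable der : 'I_n -> E -> E.
Hypothesis derE : forall j p q, q != 0 -> der j (phi p / phi q) =
  (phi p^`M(j) * phi q - phi p * phi q^`M(j)) / phi q ^+ 2.
Variable c : nat.
Hypothesis charK : has_char K c.

Local Notation ev f r := (fun j => (map_poly kappa (f j)).[r]).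
Local Notation D := (der_along der).
Local Notation df f := (fun j => (f j)^`()).
Implicit Types (H : 'I_n -> E) (f : 'I_n -> {poly K}) (p q : {mpoly K[n]}).

(** Condition (4) over an abstract copy [E] of K(x), with tuples as families. *)
Definition ratio_form H f p q : Prop :=
  [/\ q != 0, exists g, forall i, H i = g * (map_poly kappa (f i)).[phi p / phi q],
      gdot f p = 0 & gdot f q = 0].

Lemma gdotC f k : gdot f k%:MP = 0.
Proof. by apply/gdot_eq0P => k'; apply: ddirC. Qed.

Lemma ratio_form_const H g (k : 'I_n -> K) :
  (forall i, H i = g * kappa (k i)) -> exists f p q, ratio_form H f p q.
Proof.
move=> HE; exists (fun i => (k i)%:P), 0, 1; split; first exact: oner_neq0.
- by exists g => i; rewrite map_polyC hornerC.
- by rewrite -(mpolyC0 n) gdotC.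
- by rewrite -(mpolyC1 n) gdotC.
Qed.

(* A tuple of polynomials with zero derivatives is a tuple of polynomials in *)
(* the c-th power of the variable, and c-th powers have zero gradients.       *)
Lemma ratio_form_insep H g f p q :
  q != 0 -> (forall i, H i = g * (map_poly kappa (f i)).[phi p / phi q]) ->
  (forall i, (f i)^`() = 0) -> exists f p q, ratio_form H f p q.
Proof.
move=> q0 HE f0; have [c0|c0] := posnP c.
  apply: (ratio_form_const (g := g) (k := fun i => (f i)`_0)) => i.
  rewrite HE (_ : f i = ((f i)`_0)%:P) ?map_polyC ?hornerC ?coefC //.
  apply/polyP => -[|k]; rewrite coefC //=.
  by apply: (zero_deriv_coef charK) (f0 i) _; rewrite c0 dvd0n.
have gc x : gdot (fun i => \poly_(k < size (f i)) (f i)`_(c * k)) (x ^+ c) = 0.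
  rewrite /gdot big1 // => j _; rewrite mderiv_exp.
  rewrite -mulr_natl -mpolyC_nat (eqP (_ : c%:R == 0 :> K)) ?charK //.
  by rewrite mpolyC0 mul0r polyC0 mul0r.
exists (fun i => \poly_(k < size (f i)) (f i)`_(c * k)), (p ^+ c), (q ^+ c).
split=> //; first by rewrite expf_neq0.
exists g => i; rewrite HE; congr (_ * _).
have {1}-> : f i = (\poly_(k < size (f i)) (f i)`_(c * k)) \Po 'X^c.
  apply/polyP => k; rewrite coef_comp_poly_Xn // coef_poly.
  case: ifP => [ck|/negbT ck]; last by apply: (zero_deriv_coef charK) (f0 i) ck.
  rewrite [(c * _)%N]mulnC divnK //; case: ltnP => // le; rewrite nth_default //.
  by apply: leq_trans le _; apply: leq_div.
by rewrite map_comp_poly horner_comp map_polyXn hornerXn expr_div_n !rmorphXn.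
Qed.

(** The case distinction shared by (1) and (3), which enter through [main]. Either r is constant; or
    some Wronskian f_i f_j' - f_j f_i' is nonzero, hence nonzero at the transcendental r, and [main]
    applies; or all of them vanish, so that f' = 0 and [ratio_form_insep] applies. *)
Lemma ratio_form_generic H g f p q :
  gcd_one_family f -> q != 0 ->
  (forall i, H i = g * (map_poly kappa (f i)).[phi p / phi q]) ->
  (forall i j, ev f (phi p / phi q) i * ev (df f) (phi p / phi q) j -
     ev f (phi p / phi q) j * ev (df f) (phi p / phi q) i != 0 ->
   gdot f p = 0 /\ gdot f q = 0) ->
  exists f p q, ratio_form H f p q.
Proof.
move=> f1 q0 HE main; set r := phi p / phi q in HE main.
have [[k rk]|rK] := boolp.EM (exists k, r = kappa k).
  apply: (ratio_form_const (g := g) (k := fun i => (f i).[k])) => i.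
  by rewrite HE rk horner_map.
have [[i [j ij]]|prop] := boolp.EM (exists i j,
    f i * (f j)^`() - f j * (f i)^`() != 0).
  have [|fp fq] := main i j; last by exists f, p, q; split=> //; exists g.
  apply: contra_neq ij => w0.
  apply: (nonconstant_transcendental phi_inj phi_frac (r := r)).
    by move=> k rk; apply: rK; exists k.
  by rewrite rmorphB !rmorphM hornerD hornerN !hornerM.
apply: (ratio_form_insep (f := f)) HE _ => //; apply: proportional_deriv => // i j.
by apply/eqP; rewrite -subr_eq0; apply/negP => /negP ij; apply: prop; exists i, j.
Qed.

Lemma reduced_form (u : E) f H g :
  (0 < n)%N -> (forall i, H i = g * (map_poly kappa (f i)).[u]) ->
  exists g' f' p q, [/\ gcd_one_family f', gcd_one [:: p; q], q != 0 &
    forall i, H i = g' * (map_poly kappa (f' i)).[phi p / phi q]].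
Proof.
move=> n0 HE; have gcdP := gcd_domain_poly (@gcd_domain_field K).
have [d [f' [fE f'1]]] := gcd_family_factor f gcdP n0.
have [p [q [q0 uE pq]]] := reduced_fraction phi_inj phi_frac u.
exists (g * (map_poly kappa d).[u]), f', p, q; split=> // i.
by rewrite HE fE rmorphM hornerM -uE mulrA mulrAC.
Qed.

(** Write H = g' F with F = f(r), and let F' = f'(r). The derivatives of g' cancel from the tangency
    equation, which becomes (J r . F) F' = (J r . F') F. If F and F' are independent, both scalars
    vanish and [gdot_both_eq0] applies. *)
Lemma ratio_form_tangent H g f (u : E) :
  (0 < n)%N -> g != 0 -> (forall i, H i = g * (map_poly kappa (f i)).[u]) ->
  (forall i, \sum_j der j (H i) * H j = (\sum_j der j (H j)) * H i) ->
  exists f p q, ratio_form H f p q.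
Proof.
move=> n0 g0 HE tan; have [Hz|Hnz] := boolp.EM (forall i, H i = 0).
  apply: (ratio_form_const (g := 0) (k := fun=> 0)) => i.
  by rewrite mul0r Hz.
have [g' [f' [p [q [f'1 pq q0 HE']]]]] := reduced_form n0 HE.
have g'0 : g' != 0.
  by apply/eqP => g'0; apply: Hnz => i; rewrite HE' g'0 mul0r.
apply: (ratio_form_generic f'1 q0 HE') => i j w0; set r := phi p / phi q in HE' w0.
pose F k := (map_poly kappa (f' k)).[r].
pose F' k := (map_poly kappa (f' k)^`()).[r].
have derH l k : der l (H k) = der l g' * F k + g' * (F' k * der l r).
  by rewrite HE' (derM phi_inj phi_frac derE) (der_horner phi_inj phi_frac derE).
have sumH k : \sum_j der j (H k) * H j = g' * (D F g' * F k + g' * F' k * D F r).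
  rewrite mulrDr [in X in _ = X + _]mulr_suml !mulr_sumr -big_split.
  by apply: eq_bigr => l _; rewrite derH HE' -/(F l) /=; ring.
have trH : \sum_j der j (H j) = D F g' + g' * D F' r.
  by rewrite mulr_sumr -big_split; apply: eq_bigr => l _; rewrite derH /=; ring.
have eqn k : - D F' r * F k + D F r * F' k = 0.
  have /eqP : g' ^+ 2 * (- D F' r * F k + D F r * F' k) = 0.
    have := tan k; rewrite sumH trH HE' -/(F k) => /eqP; rewrite -subr_eq0 => /eqP <-.
    by ring.
  by rewrite mulf_eq0 expf_eq0 (negPf g'0) => /eqP.
have [D'0 D0] := cramer2 (eqn i) (eqn j) w0.
apply: (gdot_both_eq0 phi_inj phi_frac derE pq q0) => //.
by apply/eqP; rewrite -oppr_eq0 D'0.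
Qed.

End Classification.

(** * From homogeneous forms to ratio forms *)

Lemma comp_mpoly2_const (K : fieldType) (n : nat) (h : {mpoly K[2]}) (a b : K) :
  h \mPo [tuple a%:MP_[n]; b%:MP_[n]] = (h.@[tnth [tuple a; b]])%:MP.
Proof.
rewrite /comp_mpoly /meval /mmap [RHS]rmorph_sum; apply: eq_bigr => m _.
rewrite rmorphM rmorph_prod; congr (_ * _); apply: eq_bigr => i _.
by rewrite rmorphXn; case: i => -[|[|//]] lt.
Qed.

Lemma dhomog0_const (K : fieldType) (k : nat) (h : {mpoly K[k]}) :
  h \is 0.-homog -> h = (h@_0)%:MP.
Proof.
move=> hh; apply: msize1_polyC; apply/msize_leP => m m1.
by apply: (dhomog_nemf_coeff hh); rewrite -lt0n.
Qed.

Section HomogeneousForm.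
Variables (K E : fieldType) (n : nat) (phi : {rmorphism {mpoly K[n]} -> E}).
Hypothesis phi_inj : injective phi.
Hypothesis phi_frac : forall x, exists a b, b != 0 /\ x = phi a / phi b.
Local Notation kappa := (phi \o @mpolyC n K).
Local Notation phi0 := (phi_eq0 phi_inj).
Variable der : 'I_n -> E -> E.
Hypothesis derE : forall j p q, q != 0 -> der j (phi p / phi q) =
  (phi p^`M(j) * phi q - phi p * phi q^`M(j)) / phi q ^+ 2.
Variable c : nat.
Hypothesis charK : has_char K c.
Local Notation D := (der_along der).

(** The polynomial h(y, 1); for a form of known degree the second exponent is determined by the
    first. *)
Definition dehomogenize (h : {mpoly K[2]}) : {poly K} :=
  \sum_(m <- msupp h) h@_m *: 'X^(m 0).

Lemma dehomogenizeE d (h : {mpoly K[2]}) (p q : {mpoly K[n]}) :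
  h \is d.-homog -> q != 0 ->
  phi (h \mPo [tuple p; q]) =
    phi q ^+ d * (map_poly kappa (dehomogenize h)).[phi p / phi q].
Proof.
move=> hd q0; rewrite /comp_mpoly /mmap rmorph_sum.
rewrite /dehomogenize [map_poly _ _]rmorph_sum horner_sum mulr_sumr !big_seq.
apply: eq_bigr => m mh; rewrite /= map_polyZ map_polyXn hornerZ hornerXn.
have <- : (m 0%R + m 1%R)%N = d.
  have <- : mdeg m = d := dhomog_mf hd mh.
  by rewrite mdegE !big_ord_recl big_ord0 addn0; congr (m _ + m _)%N; apply: val_inj.
rewrite rmorphM /mmap1 !big_ord_recl big_ord0 mulr1 rmorphM !rmorphXn.
have -> : tnth [tuple p; q] ord0 = p by [].
have -> : tnth [tuple p; q] (lift ord0 ord0) = q by [].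
have -> : lift ord0 ord0 = 1 :> 'I_2 by apply: val_inj.
rewrite [RHS]mulrCA; congr (_ * _).
by rewrite expr_div_n exprD [RHS]mulrC mulrA divfK // expf_neq0 // phi0.
Qed.

(** Write h(p, q) = S F with F = f(r), f coprime, and S = q^d dd(r). The hypothesis reads (D S) F +
    S (D r) F' = 0 for D the derivation along F. If F and F' are independent, D r = D S = 0, hence d
    q^(d-1) D q = 0. As d is invertible in K, D q = 0 and then D p = 0, and [gdot_eq0] applies. *)
Lemma ratio_form_homog (H : 'I_n -> E) g (h : 'I_n -> {mpoly K[2]}) p q d :
  (0 < n)%N -> (forall i, h i \is d.-homog) -> ((0 < d)%N -> ~~ (c %| d)%N) ->
  gcd_one [:: p; q] ->
  (forall i, H i = g * phi (h i \mPo [tuple p; q])) ->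
  (forall i, \sum_j (h i \mPo [tuple p; q])^`M(j) * (h j \mPo [tuple p; q]) = 0) ->
  exists f p q, ratio_form phi H f p q.
Proof.
move=> n0 hd cd pq HE J0; set hpq := fun i => h i \mPo [tuple p; q].
have [Hz|Hnz] := boolp.EM (forall i, H i = 0).
  apply: (ratio_form_const (g := 0) (k := fun=> 0)) => i.
  by rewrite mul0r Hz.
have const (k : 'I_n -> K) : (forall i, hpq i = (k i)%:MP) ->
    exists f p q, ratio_form phi H f p q.
  by move=> hk; apply: (ratio_form_const (g := g) (k := k)) => i; rewrite HE -/(hpq i) hk.
(* If [q = 0], coprimality makes [p] a unit, hence a constant, and H is a multiple of a constant
   vector. *)
have [q0|q0] := eqVneq q 0.
  have up : p \is a GRing.unit.
    move/gcd_one2: pq; apply; first exact: dvdr_refl.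
    by rewrite q0; apply: dvdr0.
  have [a pE] : exists a, p = a%:MP.
    apply: (@dvdr_const _ _ 1); first exact: oner_neq0.
    by exists p^-1; rewrite mulVr // mpolyC1.
  apply: (const (fun i => (h i).@[tnth [tuple a; 0]])) => i.
  by rewrite /hpq q0 pE -(mpolyC0 n) comp_mpoly2_const.
have [d0|d0] := posnP d.
  apply: (const (fun i => (h i)@_0)) => i; rewrite /hpq.
  have hd0 : h i \is 0.-homog by move: (hd i); rewrite d0.
  by rewrite [in LHS](dhomog0_const hd0) comp_mpolyC.
have [dd [f [fE f1]]] := gcd_family_factor (fun i => dehomogenize (h i))
  (gcd_domain_poly (@gcd_domain_field K)) n0.
set r := phi p / phi q; pose ddr := (map_poly kappa dd).[r].
pose F k := (map_poly kappa (f k)).[r]; pose F' k := (map_poly kappa (f k)^`()).[r].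
pose S := phi q ^+ d * ddr.
have hE k : phi (hpq k) = S * F k.
  by rewrite (dehomogenizeE p (hd k) q0) fE rmorphM hornerM /S -mulrA [ddr * _]mulrC.
have HE' k : H k = (g * S) * F k by rewrite HE hE mulrA.
have S0 : S != 0.
  by apply/eqP => S0; apply: Hnz => i; rewrite HE' S0 mulr0 mul0r.
apply: (ratio_form_generic phi_inj phi_frac charK f1 q0 HE') => i j w0.
have eqn k : D F S * F k + S * D F r * F' k = 0.
  have : \sum_j phi (hpq k)^`M(j) * phi (hpq j) = 0.
    rewrite -[RHS](rmorph0 phi) -(J0 k) rmorph_sum.
    by apply: eq_bigr => l _; rewrite rmorphM.
  have -> : \sum_j phi (hpq k)^`M(j) * phi (hpq j) =
      S * (D F S * F k + S * D F r * F' k).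
    rewrite !mulr_sumr !mulr_suml -big_split mulr_sumr; apply: eq_bigr => l _.
    rewrite -(der_phi derE) !hE (derM phi_inj phi_frac derE).
    by rewrite (der_horner phi_inj phi_frac derE) -/(F' k) /=; ring.
  by move/eqP; rewrite mulf_eq0 (negPf S0) => /eqP.
have [DS /eqP] := cramer2 (eqn i) (eqn j) w0.
rewrite mulf_eq0 (negPf S0) => /eqP Dr.
have Dq : D F (phi q) = 0.
  have /eqP : D F S = 0 by [].
  rewrite /S (der_alongM phi_inj phi_frac derE) (der_along_horner phi_inj phi_frac derE).
  rewrite Dr !mulr0 addr0 (der_alongX phi_inj phi_frac derE) !mulf_eq0.
  have ddr0 : ddr != 0 by apply: contraNneq S0 => ddr0; rewrite /S ddr0 mulr0.
  have dE0 : (d%:R == 0 :> E) = false.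
    by rewrite -(rmorph_nat kappa) fmorph_eq0 charK; apply/negbTE/cd.
  by rewrite (negPf ddr0) dE0 expf_eq0 phi0 (negPf q0) andbF orbF => /eqP.
have Dp : D F (phi p) = 0.
  have -> : phi p = r * phi q by rewrite divfK // phi0.
  by rewrite (der_alongM phi_inj phi_frac derE) Dr Dq mulr0 mul0r addr0.
by split; apply: (gdot_eq0 phi_inj derE pq q0); rewrite // leq_max leqnn ?orbT.
Qed.

End HomogeneousForm.

(** * Removing common factors *)

Section Reduction.
Variables (K : fieldType) (n : nat).
Implicit Types (f : 'I_n -> {poly K}) (p q : {mpoly K[n]}) (v : 'I_n -> K).

Lemma ddirD v p q : ddir v (p + q) = ddir v p + ddir v q.
Proof. by rewrite /ddir -big_split; apply: eq_bigr => j _; rewrite mderivD scalerDr. Qed.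

Lemma gdotMr f (d : {poly K}) p :
  gdot (fun i => f i * d) p = gdot f p * map_poly (@mpolyC n K) d.
Proof.
rewrite /gdot mulr_suml; apply: eq_bigr => j _.
by rewrite rmorphM mulrA.
Qed.

Lemma gdot_cancel f (d : {poly K}) p :
  d != 0 -> gdot (fun i => f i * d) p = 0 -> gdot f p = 0.
Proof.
move=> d0; rewrite gdotMr => /eqP; rewrite mulf_eq0 => /orP[/eqP //|].
rewrite -lead_coef_eq0 lead_coef_map_inj ?mpolyC_eq0 ?lead_coef_eq0 ?(negPf d0) //.
by move=> x y /(congr1 (mcoeff 0%MM)); rewrite !mcoeffC eqxx !mulr1.
Qed.

(** The two equations give q D(p) = p D(q) for D the derivative along v. By coprimality p divides
    D(p) and q divides D(q), so both vanish by [ddir_dvdr]. *)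
Lemma ddir_coprime_eq0 v p q u :
  gcd_one [:: p; q] -> u != 0 -> ddir v (p * u) = 0 -> ddir v (q * u) = 0 ->
  ddir v p = 0 /\ ddir v q = 0.
Proof.
move=> pq u0; rewrite !ddirM => pu qu.
have E : q * ddir v p = p * ddir v q.
  apply: (mulIf u0); apply/eqP; rewrite -subr_eq0; apply/eqP.
  transitivity (q * (ddir v p * u + p * ddir v u) - p * (ddir v q * u + q * ddir v u)).
    by ring.
  by rewrite pu qu !mulr0 subrr.
have gcdK := @gcd_domain_mpolyK K n.
split; apply: ddir_dvdr.
  by apply: (euclid gcdK pq); rewrite E; apply: dvdr_mulr (dvdr_refl _).
by apply: (euclid gcdK (gcd_one2C pq)); rewrite -E; apply: dvdr_mulr (dvdr_refl _).
Qed.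

Definition weighted (f : {poly K}) d p q : {mpoly K[n]} :=
  homogenize (map_poly (@mpolyC n K) f) d p q.

Section Killed.
Variables (f : 'I_n -> {poly K}) (p q : {mpoly K[n]}) (d : nat).
Hypotheses (fp : gdot f p = 0) (fq : gdot f q = 0).
Local Notation F := (fun i => weighted (f i) d p q).

Let fk k := fun j => (f j)`_k.

Let killed k l : ddir (fk k) (p ^+ l * q ^+ (d - l)) = 0.
Proof.
move/gdot_eq0P/(_ k): fp => kp; move/gdot_eq0P/(_ k): fq => kq.
by rewrite ddirM !ddir_exp // mul0r mulr0 addr0.
Qed.

Lemma ddir_weighted k i : ddir (fk k) (F i) = 0.
Proof.
rewrite /weighted homogenize_map.
elim/big_ind: _ => [|x y x0 y0|l _]; first by rewrite -(mpolyC0 n) ddirC.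
  by rewrite ddirD x0 y0 addr0.
by rewrite -mul_mpolyC ddirM ddirC killed mul0r mulr0 addr0.
Qed.

(** The weighted tuple is a K[x]-combination of the coefficient vectors of [f], so a linear form
    that vanishes on these vectors vanishes on it. *)
Lemma sum_weighted (a : 'I_n -> {mpoly K[n]}) :
  (forall k, \sum_j (f j)`_k *: a j = 0) -> \sum_j a j * F j = 0.
Proof.
move=> a0; under eq_bigr do rewrite /weighted homogenize_map mulr_sumr.
rewrite exchange_big big1 // => l _ /=.
transitivity ((\sum_j (f j)`_l *: a j) * (p ^+ l * q ^+ (d - l))).
  by rewrite mulr_suml; apply: eq_bigr => j _; rewrite -scalerAr -scalerAl.
by rewrite a0 mul0r.
Qed.

(** The trace is the sum over l of the derivatives of p^l q^(d-l) along the l-th coefficient vector,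
    each zero by [killed]. *)
Lemma div_weighted : \sum_j (F j)^`M(j) = 0.
Proof.
under eq_bigr do rewrite /weighted homogenize_map raddf_sum.
rewrite exchange_big big1 // => l _ /=.
under eq_bigr do rewrite mderivZ.
exact: (killed l l).
Qed.

End Killed.

(* Dividing the tuple [s G] by [s]: the directional derivatives of [s] along *)
(* the coefficient vectors vanish, because [s] divides them.                  *)
Lemma jacobian_primitive_part f p q d (G : 'I_n -> {mpoly K[n]}) s :
  gdot f p = 0 -> gdot f q = 0 -> gcd_one_family G -> s != 0 ->
  (forall i, weighted (f i) d p q = s * G i) ->
  (forall i m, \sum_j (G j)@_m *: (G i)^`M(j) = 0) /\ \sum_j (G j)^`M(j) = 0.
Proof.
move=> fp fq G1 s0 FE.
have Ds k : ddir (fun j => (f j)`_k) s = 0.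
  apply: ddir_dvdr; apply: (euclid_family (@gcd_domain_mpolyK K n) G1) => i.
  have := ddir_weighted d fp fq k i; rewrite FE ddirM => /eqP.
  rewrite addr_eq0 mulrC => /eqP ->.
  by apply: dvdrN; apply: dvdr_mulr (dvdr_refl _).
have DG k i : ddir (fun j => (f j)`_k) (G i) = 0.
  have := ddir_weighted d fp fq k i; rewrite FE ddirM Ds mul0r add0r => /eqP.
  by rewrite mulf_eq0 (negPf s0) => /eqP.
have GF (a : 'I_n -> {mpoly K[n]}) :
    (forall k, \sum_j (f j)`_k *: a j = 0) -> \sum_j a j * G j = 0.
  move=> /(sum_weighted p q d) aF; apply: (mulfI s0); rewrite mulr0.
  apply: etrans aF; rewrite mulr_sumr.
  by apply: eq_bigr => j _; rewrite FE mulrCA.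
split=> [i m|].
  apply/mpolyP => be; rewrite mcoeff0.
  (* The coefficients of x^be in the partial derivatives of G_i are constants orthogonal to every
     coefficient vector of [f], hence to [G]. *)
  have aG : \sum_j ((G i)^`M(j)@_be)%:MP * G j = 0.
    apply: GF => k; have := congr1 (mcoeff be) (DG k i).
    rewrite /ddir raddf_sum mcoeff0 /= => ab.
    transitivity ((\sum_j ((f j)`_k *: (G i)^`M(j))@_be)%:MP_[n]).
      rewrite rmorph_sum; apply: eq_bigr => j _ /=.
      by rewrite mcoeffZ mpolyCM mul_mpolyC.
    by rewrite ab mpolyC0.
  apply: etrans (etrans (congr1 (mcoeff m) aG) (mcoeff0 _ m)).
  rewrite raddf_sum [RHS]raddf_sum; apply: eq_bigr => j _ /=.
  by rewrite mcoeffZ mcoeffCM mulrC.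
(* J s . G = 0 because [s] has zero derivative along the coefficient vectors of [f]; so the trace
   for s G is [s] times the trace for [G]. *)
have := div_weighted d fp fq; under eq_bigr do rewrite FE mderivM.
rewrite big_split /= (GF (fun j => s^`M(j))) // add0r -mulr_sumr => /eqP.
by rewrite mulf_eq0 (negPf s0) => /eqP.
Qed.

End Reduction.

Section PrimitivePart.
Variables (K E : fieldType) (n : nat) (phi : {rmorphism {mpoly K[n]} -> E}).
Hypothesis phi_inj : injective phi.
Hypothesis phi_frac : forall x, exists a b, b != 0 /\ x = phi a / phi b.
Local Notation kappa := (phi \o @mpolyC n K).
Local Notation phi0 := (phi_eq0 phi_inj).

Lemma weightedE (f : {poly K}) d p q : q != 0 -> (size f <= d.+1)%N ->
  phi (weighted f d p q) = phi q ^+ d * (map_poly kappa f).[phi p / phi q].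
Proof.
move=> q0 sf; rewrite homogenizeE ?phi0 //; last exact: leq_trans (size_poly _ _) sf.
by rewrite -map_poly_comp.
Qed.

(** With t = a/b in lowest terms, b G = a F; so [a] divides every G_i and is a unit. *)
Lemma primitive_multiple (F G : 'I_n -> {mpoly K[n]}) t :
  gcd_one_family G -> t != 0 -> (forall i, phi (G i) = t * phi (F i)) ->
  exists s, s != 0 /\ forall i, F i = s * G i.
Proof.
move=> G1 t0 GF; have [a [b [b0 tE ab]]] := reduced_fraction phi_inj phi_frac t.
have bG i : b * G i = a * F i.
  by apply: phi_inj; rewrite !rmorphM GF tE mulrA [phi b * _]mulrC divfK // phi0.
have ua : a \is a GRing.unit.
  apply: G1 => _ /mapP[i _ ->].
  apply: (euclid (@gcd_domain_mpolyK K n) ab); rewrite bG.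
  exact: dvdr_mulr (dvdr_refl _).
exists (a^-1 * b); split=> [|i]; last by rewrite -mulrA bG mulKr.
by rewrite mulf_neq0 // invr_eq0; apply: contraTneq ua => ->; rewrite unitr0.
Qed.

End PrimitivePart.

Lemma comp_weighted (K : fieldType) (n : nat) (f : {poly K}) d (p q : {mpoly K[n]}) :
  weighted f d 'X_(0 : 'I_2) 'X_(1 : 'I_2) \mPo [tuple p; q] = weighted f d p q.
Proof.
rewrite /weighted !homogenize_map rmorph_sum; apply: eq_bigr => k _.
rewrite [LHS]comp_mpolyZ; congr (_ *: _).
rewrite rmorphM !rmorphXn; congr (_ ^+ _ * _ ^+ _).
  exact: comp_mpolyXU.
exact: comp_mpolyXU.
Qed.

Lemma weighted_homog (K : fieldType) (f : {poly K}) d :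
  weighted f d 'X_(0 : 'I_2) 'X_(1 : 'I_2) \is d.-homog.
Proof.
rewrite /weighted homogenize_map rpred_sum // => k _; rewrite dhomogZ //.
have X1 (i : 'I_2) : ('X_i : {mpoly K[2]}) \is 1.-homog by rewrite dhomogX /= mdeg1.
have := dhomogM (dhomogMn k (X1 0)) (dhomogMn (d - k) (X1 1)).
by rewrite !mul1n subnKC // -ltnS.
Qed.

(** * From the ratio form to the primitive part and back to tangency *)

Section RatioFormConsequences.
Variables (K E : fieldType) (n : nat) (phi : {rmorphism {mpoly K[n]} -> E}).
Hypothesis phi_inj : injective phi.
Hypothesis phi_frac : forall x, exists a b, b != 0 /\ x = phi a / phi b.
Local Notation kappa := (phi \o @mpolyC n K).
Local Notation phi0 := (phi_eq0 phi_inj).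
Variable der : 'I_n -> E -> E.
Hypothesis derE : forall j p q, q != 0 -> der j (phi p / phi q) =
  (phi p^`M(j) * phi q - phi p * phi q^`M(j)) / phi q ^+ 2.
Implicit Types (H : 'I_n -> E) (f : 'I_n -> {poly K}) (p q : {mpoly K[n]}).

Lemma ratio_form_reduce H f p q : (0 < n)%N -> ratio_form phi H f p q ->
  exists f p q, [/\ ratio_form phi H f p q, gcd_one_family f & gcd_one [:: p; q]].
Proof.
move=> n0 [q0 [g HE] fp fq].
have [Hz|Hnz] := boolp.EM (forall i, H i = 0).
  (* For H = 0 the given [f] may be zero, so a coprime one is supplied, with [g = 0]. *)
  exists (fun=> 1), 0, 1; split.
  - split; first exact: oner_neq0.
    + by exists 0 => i; rewrite Hz mul0r.
    + by rewrite -(mpolyC0 n) gdotC.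
    + by rewrite -(mpolyC1 n) gdotC.
  - move=> d /(_ 1) []; last first.
      by move=> b bE; apply: (@dvdr_unit _ _ 1); [rewrite unitr1|exists b].
    by apply/mapP; exists (Ordinal n0); rewrite ?mem_enum.
  - by apply/gcd_one2 => d _; apply: dvdr_unit; rewrite unitr1.
have gcdP := gcd_domain_poly (@gcd_domain_field K).
have [d [f' [fE f'1]]] := gcd_family_factor f gcdP n0.
have [u [p' [q' [pE qE p'q']]]] := gcd_factor2 (@gcd_domain_mpolyK K n) p q.
have u0 : u != 0 by apply: contraNneq q0 => u0; rewrite qE u0 mulr0.
have q'0 : q' != 0 by apply: contraNneq q0 => q'0; rewrite qE q'0 mul0r.
have d0 : d != 0.
  by apply/eqP => d0; apply: Hnz => i; rewrite HE fE d0 mulr0 rmorph0 horner0 mulr0.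
have cancel x : gdot f x = 0 -> gdot f' x = 0.
  move=> fx; apply: (gdot_cancel d0); rewrite -[RHS]fx.
  by apply: eq_bigr => j _; rewrite fE.
move/cancel/gdot_eq0P: fp => fp; move/cancel/gdot_eq0P: fq => fq.
have both k := ddir_coprime_eq0 p'q' u0
  (etrans (congr1 _ (esym pE)) (fp k)) (etrans (congr1 _ (esym qE)) (fq k)).
exists f', p', q'; split=> //; split=> //.
- exists (g * (map_poly kappa d).[phi p / phi q]) => i.
  have -> : phi p' / phi q' = phi p / phi q.
    by rewrite pE qE !rmorphM -mulf_div divff ?mulr1 // phi0.
  by rewrite HE fE rmorphM hornerM mulrA mulrAC.
- by apply/gdot_eq0P => k; have [] := both k.
- by apply/gdot_eq0P => k; have [] := both k.
Qed.

Lemma ratio_form_weighted H f p q d : ratio_form phi H f p q ->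
  (forall i, (size (f i) <= d.+1)%N) ->
  exists g, forall i, H i = g * phi (weighted (f i) d p q).
Proof.
move=> [q0 [g HE] _ _] fd; exists (g / phi q ^+ d) => i.
by rewrite (weightedE phi_inj) // HE mulrA divfK // expf_neq0 // phi0.
Qed.

Lemma ratio_form_primitive H f p q (G : 'I_n -> {mpoly K[n]}) t :
  ratio_form phi H f p q -> gcd_one_family G -> (forall i, phi (G i) = t * H i) ->
  (forall i m, \sum_j (G j)@_m *: (G i)^`M(j) = 0) /\ \sum_j (G j)^`M(j) = 0.
Proof.
move=> Hf G1 GH; have [_ _ fp fq] := Hf.
pose d := \max_i size (f i).
have [|g Hg] := ratio_form_weighted (d := d) Hf.
  by move=> i; apply: leqW; apply: (leq_bigmax (F := fun i => size (f i))).
have Gw i : phi (G i) = (t * g) * phi (weighted (f i) d p q).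
  by rewrite GH Hg mulrA.
have tg0 : t * g != 0.
  apply/eqP => tg0; have : (0 : {mpoly K[n]}) \is a GRing.unit.
    apply: G1 => _ /mapP[i _ ->]; exists 0; rewrite mulr0; apply/eqP.
    by rewrite -phi0 Gw tg0 mul0r.
  by rewrite unitr0.
have [s [s0 sG]] := primitive_multiple phi_inj phi_frac G1 tg0 Gw.
exact: jacobian_primitive_part fp fq G1 s0 sG.
Qed.

(** For H = t G, J H . H = (J t . G) H + t^2 (J G . G) and tr J H = J t . G + t tr J G; the last
    terms vanish. *)
Lemma tangent_primitive H (G : 'I_n -> {mpoly K[n]}) t :
  (forall i, H i = t * phi (G i)) ->
  (forall i, \sum_j (G i)^`M(j) * G j = 0) -> \sum_j (G j)^`M(j) = 0 ->
  forall i, \sum_j der j (H i) * H j = (\sum_j der j (H j)) * H i.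
Proof.
move=> HE G0 tr0 i.
have derH j k : der j (H k) = der j t * phi (G k) + t * phi (G k)^`M(j).
  by rewrite HE (derM phi_inj phi_frac derE) (der_phi derE).
have -> : \sum_j der j (H j) = \sum_j der j t * phi (G j).
  under eq_bigr do rewrite derH; rewrite big_split -mulr_sumr -rmorph_sum tr0.
  by rewrite /= rmorph0 mulr0 addr0.
have -> : \sum_j der j (H i) * H j =
    (\sum_j der j t * phi (G j)) * H i + t ^+ 2 * phi (\sum_j (G i)^`M(j) * G j).
  rewrite rmorph_sum mulr_sumr mulr_suml -big_split; apply: eq_bigr => j _.
  by rewrite derH !HE rmorphM /=; ring.
by rewrite G0 rmorph0 mulr0 addr0.
Qed.

End RatioFormConsequences.

(* [Q *m B] is a projection onto the span of the coefficient vectors of [G],   *)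
(* which the Jacobian annihilates.                                             *)
Lemma coefficient_projection (K E : fieldType) (n : nat)
    (phi : {rmorphism {mpoly K[n]} -> E}) (G : 'I_n -> {mpoly K[n]}) :
  (forall i m, \sum_j (G j)@_m *: (G i)^`M(j) = 0) ->
  exists r (Q : 'M[K]_(n, r)) (B : 'M[K]_(r, n)),
    (r <= n - \rank (\matrix_(i < n, j < n) phi (G i)^`M(j)))%N /\
    forall i, G i = \sum_j (Q *m B) j i *: G j.
Proof.
move=> G0; pose ms := flatten [seq msupp (G j) | j <- enum 'I_n].
pose A : 'M[K]_(size ms, n) := \matrix_(k, j) (G j)@_(nth 0%MM ms k).
pose J := \matrix_(i < n, j < n) phi (G i)^`M(j).
pose kappa : {rmorphism K -> E} := phi \o @mpolyC n K.
have AJ : map_mx kappa A *m J^T = 0.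
  apply/matrixP => k i; rewrite !mxE.
  apply: etrans (etrans (congr1 phi (G0 i (nth 0%MM ms k))) (rmorph0 phi)).
  rewrite rmorph_sum; apply: eq_bigr => j _.
  by rewrite !mxE -mul_mpolyC rmorphM.
(* The rows of [A] are the coefficient vectors of [G]; [row_base A] is a basis of their span and
   [pinvmx] gives coordinates in it. *)
exists (\rank A), (pinvmx (row_base A)), (row_base A); split.
  have sub (a b : nat) : (a + b <= n)%N -> (a <= n - b)%N.
    by move=> ab; rewrite leq_subRL 1?addnC // (leq_trans _ ab) // leq_addl.
  (* The Jacobian kills the rows of [A], so the two ranks add up to at most [n]. *)
  have := mulmx0_rank_max AJ; rewrite mxrank_tr mxrank_map.
  exact: sub.
move=> i; apply/mpolyP => m; rewrite raddf_sum.
under eq_bigr do rewrite /= mcoeffZ.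
have [mms|mms] := boolP (m \in ms); last first.
  have G_m j : (G j)@_m = 0.
    apply: memN_msupp_eq0; apply: contra mms => mG; apply/flatten_mapP.
    by exists j => //; rewrite mem_enum.
  by rewrite G_m big1 // => j _; rewrite G_m mulr0.
have mlt : (index m ms < size ms)%N by rewrite index_mem.
have AP : A *m (pinvmx (row_base A) *m row_base A) = A.
  by rewrite mulmxA mulmxKpV // eq_row_base.
have := congr1 (fun M : 'M_(size ms, n) => M (Ordinal mlt) i) AP.
rewrite [in RHS]mxE /= nth_index // => <-; rewrite mxE.
by apply: eq_bigr => j _; rewrite mxE /= nth_index // mulrC.
Qed.

Lemma meval_diagonal (R : comNzRingType) (n : nat) (p : {mpoly R[n]}) :
  (map_mpoly (@mpolyC n R) p).@[fun i => 'X_i] = p.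
Proof.
pose f : {rmorphism _ -> _} :=
  meval (fun i => 'X_i : {mpoly R[n]}) \o map_mpoly (@mpolyC n R).
have: f =1 idfun; last exact.
apply: mpoly_rmorph_ext => [c|i]; rewrite /f /=.
  by rewrite map_mpolyC mevalC.
by rewrite map_mpolyX mevalXU.
Qed.

(** The [r] basis vectors are padded with zeros to [N]. The scalars are K-combinations of the
    entries of [H], which makes them polynomials whenever these entries are. *)
Lemma linear_combination (K E : fieldType) (kappa : {rmorphism K -> E}) (n r N : nat)
    (H : 'cV[E]_n) (Q : 'M[K]_(n, r)) (B : 'M[K]_(r, n)) :
  (r <= N)%N -> (forall i, H i 0 = \sum_j kappa ((Q *m B) j i) * H j 0) ->
  exists (v : 'I_N -> 'cV[K]_n) (C : 'I_N -> 'I_n -> K),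
    H = \sum_k (\sum_j kappa (C k j) * H j 0) *: map_mx kappa (v k).
Proof.
move=> rN HE.
pose w (k : nat) := if insub k is Some l then (row l B)^T else 0 : 'cV[K]_n.
pose C (k : nat) j := if insub k is Some l then Q j l else 0.
pose T k := (\sum_j kappa (C k j) * H j 0) *: map_mx kappa (w k).
exists (fun k => w k), (fun k => C k); rewrite -[RHS]/(\sum_(k < N) T k).
have -> : \sum_(k < N) T k = \sum_(k < r) T k.
  rewrite (big_ord_widen _ T rN) [RHS]big_mkcond; apply: eq_bigr => k _.
  by case: ifPn => // kr; rewrite /T /w insubN // map_mx0 scaler0.
apply/colP => i; rewrite HE summxE.
under eq_bigr do rewrite mxE rmorph_sum mulr_suml.
rewrite exchange_big; apply: eq_bigr => l _.
rewrite /T /C /w insubT // => lr /=; rewrite !mxE mulr_suml.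
rewrite (_ : Sub _ _ = l); last exact: val_inj.
by apply: eq_bigr => j _; rewrite rmorphM mulrAC.
Qed.

(** * The matrix equations in coordinates *)

Section Translation.
Variables (K : fieldType) (n : nat).
Local Notation phi := (pfrac K n).
Implicit Types (H : 'cV[ratfun K n]_n) (G : 'cV[{mpoly K[n]}]_n).

Lemma fderiv_quotient j (p q : {mpoly K[n]}) : q != 0 ->
  fderiv j (phi p / phi q) =
    (phi p^`M(j) * phi q - phi p * phi q^`M(j)) / phi q ^+ 2.
Proof. by move=> q0; rewrite fderivE // rmorphXn rmorphB !rmorphM. Qed.

Lemma tangentP H :
  jacobian_frac H *m H = \tr (jacobian_frac H) *: H <->
  forall i, \sum_j fderiv j (H i 0) * H j 0 = (\sum_j fderiv j (H j 0)) * H i 0.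
Proof.
have trE : \tr (jacobian_frac H) = \sum_j fderiv j (H j 0).
  by apply: eq_bigr => j _; rewrite mxE.
have mulE i : (jacobian_frac H *m H) i 0 = \sum_j fderiv j (H i 0) * H j 0.
  by rewrite mxE; apply: eq_bigr => j _; rewrite mxE.
split=> [JH i|JH]; first by rewrite -mulE JH mxE trE.
by apply/colP => i; rewrite mulE JH mxE trE.
Qed.

Lemma gradient_dotP (p : {mpoly K[n]}) (f : 'cV[{poly K}]_n) :
  gradient_dot p f = 0 <-> gdot (fun i => f i 0) p = 0.
Proof.
have E : gradient_dot p f 0 0 = gdot (fun i => f i 0) p.
  by rewrite mxE; apply: eq_bigr => j _; rewrite !mxE.
split=> [f0|f0]; first by rewrite -E f0 mxE.
by apply/matrixP => i j; rewrite !ord1 E f0 mxE.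
Qed.

Lemma ratio_formP H (f : 'cV[{poly K}]_n) (p q : {mpoly K[n]}) :
  ratio_form phi (fun i => H i 0) (fun i => f i 0) p q <->
  [/\ q != 0, exists g, H = g *: eval_frac f (phi p / phi q),
      gradient_dot p f = 0 & gradient_dot q f = 0].
Proof.
split=> -[q0 [g HE] fp fq]; split=> //; try exact/gradient_dotP.
- by exists g; apply/colP => i; rewrite HE !mxE.
- by exists g => i; rewrite HE !mxE.
Qed.

Lemma subst_y_coef G i m :
  (map_mx (@subst_y K n) G i 0)@_m = ((G i 0)@_m)%:MP.
Proof. by rewrite mxE mcoeff_map_mpoly. Qed.

Lemma jacobian_substP G :
  map_mx (@pconst_y K n) (jacobian G) *m map_mx (@subst_y K n) G = 0 <->
  forall i m, \sum_j (G j 0)@_m *: (G i 0)^`M(j) = 0.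
Proof.
have E i m : ((map_mx (@pconst_y K n) (jacobian G) *m map_mx (@subst_y K n) G) i 0)@_m
    = \sum_j (G j 0)@_m *: (G i 0)^`M(j).
  rewrite mxE raddf_sum; apply: eq_bigr => j _ /=.
  by rewrite mxE /pconst_y mcoeffCM subst_y_coef mxE mulrC mul_mpolyC.
split=> [JG i m|JG]; first by rewrite -E JG mxE mcoeff0.
by apply/colP => i; apply/mpolyP => m; rewrite E JG mxE mcoeff0.
Qed.

Lemma trace_jacobian G : \tr (jacobian G) = \sum_j (G j 0)^`M(j).
Proof. by apply: eq_bigr => j _; rewrite mxE. Qed.

Lemma pconst_scale_eq0 (c : {mpoly K[n]}) G : G != 0 ->
  pconst_y c *: map_mx (@subst_y K n) G = 0 -> c = 0.
Proof.
move=> /cV0Pn[i Gi0] /colP/(_ i)/(congr1 (mcoeff (mlead (G i 0)))).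
rewrite mxE /pconst_y mcoeffCM subst_y_coef mxE mcoeff0 => /eqP.
by rewrite mulf_eq0 mpolyC_eq0 mleadc_eq0 (negPf Gi0) orbF => /eqP.
Qed.

(** The substitution y = x in J G . G(y) = 0. *)
Lemma coefficient_annihilation G :
  (forall i m, \sum_j (G j 0)@_m *: (G i 0)^`M(j) = 0) ->
  forall i, \sum_j (G i 0)^`M(j) * G j 0 = 0.
Proof.
move=> G0 i; pose S := \sum_j ((G i 0)^`M(j))%:MP * map_mpoly (@mpolyC n K) (G j 0).
have S0 : S = 0.
  apply/mpolyP => m; rewrite mcoeff0 -(G0 i m) raddf_sum; apply: eq_bigr => j _ /=.
  by rewrite mcoeffCM mcoeff_map_mpoly mulrC mul_mpolyC.
transitivity (S.@[fun i => 'X_i]); last by rewrite S0 meval0.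
rewrite rmorph_sum; apply: eq_bigr => j _.
by rewrite rmorphM /= mevalC meval_diagonal.
Qed.

Lemma jacobian_mulP G :
  jacobian G *m G = 0 <-> forall i, \sum_j (G i 0)^`M(j) * G j 0 = 0.
Proof.
have E i : (jacobian G *m G) i 0 = \sum_j (G i 0)^`M(j) * G j 0.
  by rewrite mxE; apply: eq_bigr => j _; rewrite mxE.
split=> [JG i|JG]; first by rewrite -E JG mxE.
by apply/colP => i; rewrite E JG mxE.
Qed.

End Translation.

Theorem theorem4p3 (K : fieldType) (c : nat) (n : nat)
    (H : 'cV[ratfun K n]_n) (Ht : 'cV[{mpoly K[n]}]_n) :
  has_char K c -> (0 < n)%N ->
  trdeg_le (cfrac_t K n) (adjoin (cfrac_t K n) (t_scale H)) 2 ->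
  primitive_part H Ht ->
  let c1 :=
    jacobian_frac H *m H = \tr (jacobian_frac H) *: H in
  let c2 :=
    map_mx (@pconst_y K n) (jacobian Ht) *m map_mx (@subst_y K n) Ht =
      pconst_y (\tr (jacobian Ht)) *: map_mx (@subst_y K n) Ht /\
    pconst_y (\tr (jacobian Ht)) *: map_mx (@subst_y K n) Ht = 0 in
  let c3 :=
    exists (h : 'cV[{mpoly K[2]}]_n) (p q : {mpoly K[n]}),
      [/\ h = 0 \/
            (exists d : nat,
               homog_tuple h d /\ ((0 < d)%N -> ~~ (c %| d)%N)),
          gcd_one [:: p; q],
          exists g : ratfun K n, H = g *: map_mx (pfrac K n) (subst2 h p q)
        & jacobian (subst2 h p q) *m subst2 h p q = 0] in
  let c4_for (f : 'cV[{poly K}]_n) (p q : {mpoly K[n]}) :=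
    [/\ q != 0,
        exists g : ratfun K n,
          H = g *: eval_frac f (pfrac K n p / pfrac K n q),
        gradient_dot p f = 0
      & gradient_dot q f = 0] in
  let c4 := exists f p q, c4_for f p q in
  let c5 :=
    exists f p q, [/\ c4_for f p q, gcd_one_cv f & gcd_one [:: p; q]] in
  [<-> c1; c2; c3; c4; c5] /\
  ([\/ c1, c2, c3 | c4] \/ c5 ->
   exists (v : 'I_(n - \rank (map_mx (pfrac K n) (jacobian Ht))) -> 'cV[K]_n)
          (a : 'I_(n - \rank (map_mx (pfrac K n) (jacobian Ht))) ->
               ratfun K n),
     H = \sum_k a k *: map_mx (cfrac K n) (v k) /\
     ((forall i, is_polynomial (H i 0)) -> forall k, is_polynomial (a k))).
Proof.
move=> charK n0 tr prim c1 c2 c3 c4_for c4 c5.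
have inj := @pfrac_inj K n; have frac := @ratfun_frac K n.
have derE := @fderiv_quotient K n.
pose form := ratio_form (pfrac K n) (fun i => H i 0).
have formP (f : 'I_n -> {poly K}) p q : form f p q <-> c4_for (\col_i f i) p q.
  apply: (iff_trans _ (ratio_formP H (\col_i f i) p q)); split; last first.
    case=> q0 [g HE] fp fq; split=> //; first by exists g => i; rewrite HE mxE.
      by rewrite -[RHS]fp; apply: eq_bigr => j _; rewrite mxE.
    by rewrite -[RHS]fq; apply: eq_bigr => j _; rewrite mxE.
  case=> q0 [g HE] fp fq; split=> //; first by exists g => i; rewrite HE mxE.
    by rewrite -[RHS]fp; apply: eq_bigr => j _; rewrite mxE.
  by rewrite -[RHS]fq; apply: eq_bigr => j _; rewrite mxE.
have form4 : (exists f p q, form f p q) <-> c4.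
  split=> [[f [p [q /formP Hf]]]|[f [p [q Hf]]]]; first by exists (\col_i f i), p, q.
  by exists (fun i => f i 0), p, q; apply/ratio_formP.
have prim' : H != 0 -> gcd_one_family (fun i => Ht i 0) /\
    exists g, forall i, pfrac K n (Ht i 0) = g * H i 0.
  move: prim; rewrite /primitive_part => + H0; rewrite (negPf H0) => -[[_ G1] [g gE]].
  split=> //; exists g => i.
  by have /colP/(_ i) := gE; rewrite !mxE.
have Ht0 : H != 0 -> Ht != 0.
  by move: prim; rewrite /primitive_part => + H0; rewrite (negPf H0) => -[[]].
(* Comparing coefficients in y turns (2) into equations on the coefficient vectors of [Ht]; the
   product of the trace with a nonzero Ht(y) vanishes only if the trace does. *)
have c2P : c2 <-> (forall i m, \sum_j (Ht j 0)@_m *: (Ht i 0)^`M(j) = 0) /\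
    (H != 0 -> \sum_j (Ht j 0)^`M(j) = 0).
  rewrite /c2; split=> [[E E0]|[/jacobian_substP J0 t0]].
    split; first by apply/jacobian_substP; rewrite E E0.
    by move=> /Ht0 Htn; rewrite -trace_jacobian; apply: pconst_scale_eq0 E0.
  suff E0 : pconst_y (\tr (jacobian Ht)) *: map_mx (@subst_y K n) Ht = 0 by rewrite E0.
  have [H0|/t0] := eqVneq H 0.
    move: prim; rewrite /primitive_part H0 eqxx => ->.
    rewrite [map_mx _ _](_ : _ = 0) ?scaler0 //; apply/colP => i; rewrite !mxE.
    exact: (raddf0 (map_mpoly (@mpolyC n K))).
  by rewrite -trace_jacobian => ->; rewrite /pconst_y mpolyC0 scale0r.
have T14 : c1 -> c4.
  rewrite /c1 tangentP => tan; apply/form4.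
  have [H0|H0] := eqVneq H 0.
    apply: (ratio_form_const (g := 0) (k := fun=> 0)) => i.
    by rewrite H0 mxE mul0r.
  (* Here the bound on the transcendence degree enters. *)
  have [u [g [f HE]]] := luroth_tuple H0 tr.
  have g0 : g != 0 by apply: contraNneq H0 => g0; rewrite HE g0 scale0r.
  apply: (ratio_form_tangent inj frac derE charK n0 g0
    (f := fun i => f i 0) (u := u)) => // i.
  by rewrite [in LHS]HE !mxE.
have T42 : c4 -> c2.
  move=> /form4[f [p [q Hf]]]; apply/c2P.
  have [H0|H0] := eqVneq H 0.
    split=> // i m; move: prim; rewrite /primitive_part H0 eqxx => ->.
    by rewrite big1 // => j _; rewrite mxE mcoeff0 scale0r.
  have [G1 [g gE]] := prim' H0.
  by have [A B] := ratio_form_primitive inj frac Hf G1 gE.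
have T21 : c2 -> c1.
  move=> /c2P[J0 t0]; rewrite /c1.
  have [H0|H0] := eqVneq H 0; first by rewrite H0 mulmx0 scaler0.
  have [G1 [g gE]] := prim' H0.
  have g0 : g != 0.
    move: (Ht0 H0); apply: contraNneq => g0; apply/eqP/colP => i; apply: inj.
    by rewrite gE g0 mul0r mxE rmorph0.
  apply/tangentP; apply: (tangent_primitive inj frac derE (t := g^-1)
    (G := fun i => Ht i 0)).
  - by move=> i; rewrite gE mulKf.
  - exact: coefficient_annihilation.
  - exact: t0.
have T45 : c4 -> c5.
  move=> /form4[f [p [q Hf]]].
  have [f' [p' [q' [/formP Hf' f1 pq]]]] := ratio_form_reduce inj n0 Hf.
  exists (\col_i f' i), p', q'; split=> //.
  rewrite /gcd_one_cv; have -> // : [seq (\col_i f' i) i 0 | i <- enum 'I_n] =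
    [seq f' i | i <- enum 'I_n] by apply: eq_map => i; rewrite mxE.
have T54 : c5 -> c4 by move=> [f [p [q [Hf _ _]]]]; exists f, p, q.
have T53 : c5 -> c3.
  move=> [f [p [q [/ratio_formP Hf _ pq]]]].
  have [H0|H0] := eqVneq H 0.
    exists 0, p, q; split=> //; first by left.
      by exists 0; rewrite scale0r.
    apply/jacobian_mulP => i; rewrite big1 // => j _.
    by rewrite !mxE comp_mpoly0 mulr0.
  pose d0 := \max_i size (f i 0%R).
  (* [d0] bounds the sizes of the f_i; one of [d0] and [d0.+1] is not divisible by [c], because [c]
     is not 1. *)
  have [d [d0d cd]] : exists d, (d0 <= d)%N /\ ((0 < d)%N -> ~~ (c %| d)%N).
    have [cd|cd] := boolP (c %| d0)%N; last by exists d0.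
    exists d0.+1; split=> // _; rewrite -addn1 dvdn_addr // dvdn1.
    by apply/eqP => c_1; have := charK 1%N; rewrite c_1 oner_eq0.
  have sf i : (size (f i 0%R) <= d.+1)%N.
    by apply/leqW/(leq_trans _ d0d)/(leq_bigmax (F := fun i => size (f i 0%R))).
  have [g gE] := ratio_form_weighted inj Hf sf.
  pose h : 'cV[{mpoly K[2]}]_n := \col_i weighted (f i 0) d 'X_0 'X_1.
  have hE i : subst2 h p q i 0 = weighted (f i 0) d p q.
    by rewrite !mxE comp_weighted.
  exists h, p, q; split=> //.
  - right; exists d; split=> //; split; last by move=> i; rewrite mxE weighted_homog.
    apply: contraNneq H0 => h0; apply/eqP/colP => i.
    by rewrite gE -hE h0 !mxE comp_mpoly0 rmorph0 mulr0.
  - by exists g; apply/colP => i; rewrite gE -hE !mxE.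
  apply/jacobian_mulP => i; have [_ _ fp fq] := Hf.
  under eq_bigr do rewrite !hE.
  apply: (sum_weighted (f := fun i => f i 0)) => k.
  exact: (ddir_weighted (f := fun i => f i 0) d fp fq k i).
have T34 : c3 -> c4.
  move=> [h [p [q [hd pq [g HE] /jacobian_mulP J0]]]]; apply/form4.
  have [d [hh cd]] : exists d, (forall i, h i 0 \is d.-homog) /\
      ((0 < d)%N -> ~~ (c %| d)%N).
    case: hd => [->|[d [[_ hh] cd]]]; last by exists d.
    (* The zero tuple is treated as homogeneous of degree 0. *)
    by exists 0%N; split=> // i; rewrite mxE dhomog0.
  apply: (ratio_form_homog inj frac derE charK n0
    (h := fun i => h i 0) (g := g) hh cd pq).
    by move=> i; rewrite [in LHS]HE !mxE.
  by move=> i; rewrite -[RHS](J0 i); apply: eq_bigr => j _; rewrite !mxE.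
split.
  tfae.
  - by move=> /T14/T42.
  - by move=> /T21/T14/T45/T53.
  - exact: T34.
  - exact: T45.
  - by move=> /T54/T42/T21.
move=> any; have /c2P[J0 _] : c2.
  by case: any => [[/T14/T42|//|/T34/T42|/T42]|/T54/T42].
have [r [Q [B [rN QB]]]] := coefficient_projection (pfrac K n) J0.
(* The projection, being linear over K(x), fixes H because it fixes the proportional tuple [Ht]. *)
have HP i : H i 0 = \sum_j cfrac K n ((Q *m B) j i) * H j 0.
  have [H0|H0] := eqVneq H 0.
    by rewrite H0 mxE big1 // => j _; rewrite [X in _ * X]mxE mulr0.
  have [G1 [g gE]] := prim' H0.
  have g0 : g != 0.
    move: (Ht0 H0); apply: contraNneq => g0; apply/eqP/colP => k; apply: inj.
    by rewrite gE g0 mul0r mxE rmorph0.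
  apply: (mulfI g0); rewrite -gE [in LHS]QB rmorph_sum mulr_sumr.
  by apply: eq_bigr => j _; rewrite -mul_mpolyC rmorphM gE mulrCA.
have JE : \matrix_(i < n, j < n) pfrac K n (Ht i 0)^`M(j) =
    map_mx (pfrac K n) (jacobian Ht).
  by apply/matrixP => i j; rewrite !mxE.
rewrite JE in rN.
have [v [C HC]] := linear_combination rN HP.
exists v, (fun k => \sum_j cfrac K n (C k j) * H j 0); split=> // Hpol k.
have [p pE] := boolp.choice Hpol.
exists (\sum_j C k j *: p j); rewrite rmorph_sum; apply: eq_bigr => j _.
by rewrite pE -mul_mpolyC rmorphM.
Qed.
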